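(* (i) For any class $\mathcal{C}$ of linear orders containing an infinite order, $\mathcal{C}(<)$-satisfiability of $\mathcal{HS}_{\mathit{core}}$-formulas is undecidable. (ii) $\mathsf{Fin}(<)$-satisfiability of $\mathcal{HS}_{\mathit{core}}$-formulas is undecidable.
   Context: For a linear order $(T,\le)$, intervals are pairs $\langle x,y\rangle$ with $x\le y$ (punctual allowed). Irreflexive interval relations: $\langle x_1,y_1\rangle\mathsf{A}\langle x_2,y_2\rangle$ iff $y_1=x_2$, $x_2<y_2$; $\mathsf{B}$: $x_1=x_2$, $y_2<y_1$; $\mathsf{E}$: $x_1<x_2$, $y_1=y_2$; $\mathsf{D}$: $x_1<x_2$, $y_2<y_1$; $\mathsf{L}$: $y_1<x_2$; $\mathsf{O}$: $x_1<x_2<y_1<y_2$; $\bar{\mathsf{A}}$: $y_2=x_1$, $x_2<y_2$; $\bar{\mathsf{B}}$: $x_1=x_2$, $y_1<y_2$; $\bar{\mathsf{E}}$: $x_2<x_1$, $y_1=y_2$; $\bar{\mathsf{D}}$: $x_2<x_1$, $y_1<y_2$; $\bar{\mathsf{L}}$: $y_2<x_1$; $\bar{\mathsf{O}}$: $x_2<x_1<y_2<y_1$. Literals $\lambda::=\top\mid\bot\mid p\mid\langle\mathsf{R}\rangle\lambda\mid[\mathsf{R}]\lambda$. $\mathcal{HS}_{\mathit{horn}}$-formulas: $\varphi::=\lambda\mid[\mathsf{U}](\lambda_1\wedge\dots\wedge\lambda_k\to\lambda)\mid\varphi_1\wedge\varphi_2$. $\mathcal{HS}_{\mathit{core}}$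 consists of the $\mathcal{HS}_{\mathit{horn}}$-formulas all of whose clauses have the form $[\mathsf{U}](\lambda_1\to\lambda_2)$ or $[\mathsf{U}](\lambda_1\wedge\lambda_2\to\bot)$. A model assigns sets of intervals to variables; $\langle\mathsf{R}\rangle\lambda$/$[\mathsf{R}]\lambda$ hold iff $\lambda$ holds at some/every $\mathsf{R}$-successor; $[\mathsf{U}](\lambda_1\wedge\dots\wedge\lambda_k\to\lambda)$ holds iff $\lambda$ holds at every interval where all $\lambda_i$ hold. For a class $\mathcal{C}$, $\varphi$ is $\mathcal{C}(<)$-satisfiable if it is true at some interval of some model based on some order in $\mathcal{C}$ with these irreflexive relations. $\mathsf{Fin}$ is the class of finite linear orders. *)

(* Defs.v *)
From HB Require Import structures.
From mathcomp Require Import all_boot all_order.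
From mathcomp Require Import boolp classical_sets functions cardinality.
From Stdlib Require List.
Set Implicit Arguments.
Unset Strict Implicit.
Unset Printing Implicit Defensive.

Local Open Scope classical_set_scope.

Inductive hs_rel :=
  | RA | RB | RE | RD | RL | RO
  | RAbar | RBbar | REbar | RDbar | RLbar | RObar.

Inductive literal :=
  | Top
  | Bot
  | Var of nat
  | Dia of hs_rel & literal
  | Box of hs_rel & literal.

(* [Clause [:: l1; ...; lk] l] is the clause [U](l1 /\ ... /\ lk -> l). *)
Inductive hs_horn :=
  | Lit of literal
  | Clause of seq literal & literal
  | And of hs_horn & hs_horn.

Fixpoint is_core (phi : hs_horn) : bool :=
  match phi with
  | Lit _ => true
  | Clause [:: _] _ => true
  | Clause [:: _; _] Bot => true
  | Clause _ _ => false
  | And phi1 phi2 => is_core phi1 && is_core phi2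
  end.

(* Punctual intervals <x, x> are included. *)
Record ival d (T : orderType d) :=
  Ival { lo : T; hi : T; lo_le_hi : (lo <= hi)%O }.

(* The irreflexive reading. [RAbar] is not the converse of [RA] on punctual
   intervals: in both it is the accessed interval that must be non-punctual. *)
Definition rel_sem d (T : orderType d) (R : hs_rel) (i j : ival T) : Prop :=
  let x1 := lo i in let y1 := hi i in let x2 := lo j in let y2 := hi j in
  match R with
  | RA => y1 = x2 /\ (x2 < y2)%O
  | RB => x1 = x2 /\ (y2 < y1)%O
  | RE => (x1 < x2)%O /\ y1 = y2
  | RD => (x1 < x2)%O /\ (y2 < y1)%O
  | RL => (y1 < x2)%O
  | RO => [/\ (x1 < x2)%O, (x2 < y1)%O & (y1 < y2)%O]
  | RAbar => y2 = x1 /\ (x2 < y2)%O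
  | RBbar => x1 = x2 /\ (y1 < y2)%O
  | REbar => (x2 < x1)%O /\ y1 = y2
  | RDbar => (x2 < x1)%O /\ (y1 < y2)%O
  | RLbar => (y2 < x1)%O
  | RObar => [/\ (x2 < x1)%O, (x1 < y2)%O & (y2 < y1)%O]
  end.

Fixpoint lit_holds d (T : orderType d) (V : nat -> set (ival T))
    (i : ival T) (l : literal) : Prop :=
  match l with
  | Top => True
  | Bot => False
  | Var p => V p i
  | Dia R l => exists j, rel_sem R i j /\ lit_holds V j l
  | Box R l => forall j, rel_sem R i j -> lit_holds V j l
  end.

Fixpoint holds d (T : orderType d) (V : nat -> set (ival T))
    (i : ival T) (phi : hs_horn) : Prop :=
  match phi with
  | Lit l => lit_holds V i l
  | Clause ls l =>
      forall j, List.Forall (lit_holds V j) ls -> lit_holds V j l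
  | And phi1 phi2 => holds V i phi1 /\ holds V i phi2
  end.

Definition satisfiable d (C : orderType d -> Prop) (phi : hs_horn) : Prop :=
  exists T : orderType d,
    C T /\ exists (V : nat -> set (ival T)) (i : ival T), holds V i phi.

Definition Fin d (T : orderType d) : Prop :=
  finite_set [set: T].

Inductive murec : nat -> Type :=
  | Zero : murec 0
  | Succ : murec 1
  | Proj n : 'I_n -> murec n
  | Comp k n : murec k -> ('I_k -> murec n) -> murec n
  | Prec n : murec n -> murec n.+2 -> murec n.+1
  | Mu n : murec n.+1 -> murec n.

(* [eval f v r]: f is defined at v, with value r. The recursion variable of
   [Prec] and the search variable of [Mu] are the first argument; [Mu f] is
   defined at v only if f is defined on every candidate up to the least zero. *)
Fixpoint eval n (f : murec n) : n.-tuple nat -> nat -> Prop :=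
  match f in murec n return n.-tuple nat -> nat -> Prop with
  | Zero => fun _ r => r = 0
  | Succ => fun v r => r = (thead v).+1
  | Proj _ i => fun v r => r = tnth v i
  | Comp k _ f gs => fun v r =>
      exists w : k.-tuple nat,
        (forall i, eval (gs i) v (tnth w i)) /\ eval f w r
  | Prec _ f g => fun v r =>
      let u := behead_tuple v in
      (fix rec m r := match m with
        | 0 => eval f u r
        | m.+1 => exists s, rec m s /\ eval g (cons_tuple m (cons_tuple s u)) r
        end) (thead v) r
  | Mu _ f => fun v r =>
      eval f (cons_tuple r v) 0 /\
      forall m, m < r -> exists s, eval f (cons_tuple m v) s.+1
  end.

(* [CodeSeq.code] is the bijection from seq nat to nat with code [::] = 0 and
   code (n :: s) = 2 ^ n * (2 * code s + 1). *)
Definition code_rel (R : hs_rel) : nat :=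
  match R with
  | RA => 0 | RB => 1 | RE => 2 | RD => 3 | RL => 4 | RO => 5
  | RAbar => 6 | RBbar => 7 | REbar => 8 | RDbar => 9 | RLbar => 10
  | RObar => 11
  end.

Fixpoint code_lit (l : literal) : nat :=
  match l with
  | Top => CodeSeq.code [:: 0]
  | Bot => CodeSeq.code [:: 1]
  | Var p => CodeSeq.code [:: 2; p]
  | Dia R l => CodeSeq.code [:: 3; code_rel R; code_lit l]
  | Box R l => CodeSeq.code [:: 4; code_rel R; code_lit l]
  end.

Fixpoint code_horn (phi : hs_horn) : nat :=
  match phi with
  | Lit l => CodeSeq.code [:: 0; code_lit l]
  | Clause ls l =>
      CodeSeq.code [:: 1; CodeSeq.code (map code_lit ls); code_lit l]
  | And phi1 phi2 => CodeSeq.code [:: 2; code_horn phi1; code_horn phi2]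
  end.

Lemma code_rel_inj : injective code_rel.
Proof. by case; case. Qed.

Lemma code_inj : injective CodeSeq.code.
Proof. exact: can_inj CodeSeq.codeK. Qed.

Lemma code_lit_inj : injective code_lit.
Proof.
elim=> [||p|R l IH|R l IH] [||q|S m|S m] /code_inj //; case=> //.
- by move=> ->.
- by move=> /code_rel_inj -> /IH ->.
- by move=> /code_rel_inj -> /IH ->.
Qed.

Lemma code_horn_inj : injective code_horn.
Proof.
elim=> [l|ls l|a IHa b IHb] [m|ms m|a' b'] /code_inj //; case=> //.
- by move=> /code_lit_inj ->.
- move=> H /code_lit_inj ->; have {H} := code_inj H.
  by move=> /(inj_map code_lit_inj) ->.
- by move=> /IHa -> /IHb ->.
Qed.

(* The values of a decision procedure at numbers that do not code an instance
   of the problem are irrelevant, and need not be defined. *)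
Definition decides X (code : X -> nat) (instance : pred X) (P : X -> Prop)
    (f : murec 1) : Prop :=
  forall x, instance x ->
    (P x -> eval f [tuple code x] 1) /\ (~ P x -> eval f [tuple code x] 0).

Definition undecidable X (code : X -> nat) (instance : pred X)
    (P : X -> Prop) : Prop :=
  ~ exists f : murec 1, decides code instance P f.

(* Main.v *)
Require Import Defs.
From mathcomp Require Import all_boot all_order.
From mathcomp Require Import boolp classical_sets functions cardinality.
From mathcomp Require Import zify.
From Stdlib Require List.
Set Implicit Arguments.
Unset Strict Implicit.
Unset Printing Implicit Defensive.

Import Order.TTheory.

(** A deterministic queue machine is simulated by an HS_core formula. A run is
    written on an increasing sequence of points p 0 < p 1 < ..., the intervals
    (p i, p i+1) being cells of two kinds: a letter cell pushes its letter on the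
    queue, a read cell in state s pops a letter a and thereby decides, through
    delta s a, which cells follow. A "match" is an interval from the beginning of
    a letter cell to the end of the read cell that pops it. Every letter cell
    begins a match, every read cell ends one, and no match begins, ends or
    strictly contains another one; this forces the i-th letter to be matched to
    the i-th read, although core formulas do not control where the witness of a
    diamond lies.

    What remains is to derive the outcome of a step from the conjunction of a
    state and a letter, which core clauses cannot state. The box on the left-hand
    side of [A]fill -> ... is used instead: all intervals beginning at the point
    y carry fill(a, s) exactly if y begins a read cell in state s whose match
    carries the letter a, because the state fills all of these intervals except
    the read cell itself, and only the match fills the latter. No other point is
    filled completely, so this also works in the presence of points inside cells.

    If halting is forbidden, the formula is satisfiable exactly if the machine
    runs forever, in any order with an infinite ascending chain; orders with a
    descending chain are treated by reversing all relations. If halting is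
    allowed, it is satisfiable in a finite order exactly if the machine halts.

    Partial recursive functions are compiled to queue machines through while
    programs. A decision procedure would yield a machine that, applied to the
    code of the part of the formula that describes the machine itself, does the
    opposite of what was decided. *)

Lemma In_cat A (x : A) s t :
  List.In x (s ++ t) <-> List.In x s \/ List.In x t.
Proof. exact: (List.in_app_iff s t x). Qed.

Lemma In_map A B (f : A -> B) x s : List.In x s -> List.In (f x) (map f s).
Proof. by elim: s => //= y s IH [->|/IH]; [left|right]. Qed.

Lemma In_allpairs A B C (f : A -> B -> C) x y s t :
  List.In x s -> List.In y t -> List.In (f x y) [seq f a b | a <- s, b <- t].
Proof.
move=> xs yt; elim: s xs => //= z s IH [->|/IH ?]; apply/In_cat; last by right.
by left; exact: (@In_map _ _ (f x)).
Qed.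

(** * Queue machines *)

Section QueueMachine.

Variables (S : Type) (s0 : S) (delta : S -> nat -> option (seq nat * S)).

(* [Inp n] is the first of the cells spelling the initial queue 1^n 0. [Cell v s]
   is the letter cell of the head of v if v is not empty, and the read cell in
   state s otherwise. *)
Inductive cell := Inp of nat | Cell of seq nat & S | Junk | Blank.

Definition letter (c : cell) : option nat :=
  match c with
  | Inp 0 => Some 0
  | Inp _.+1 => Some 1
  | Cell (b :: _) _ => Some b
  | _ => None
  end.

Definition next (c : cell) : cell :=
  match c with
  | Inp 0 => Cell [::] s0
  | Inp k.+1 => Inp k
  | Cell (_ :: v) s => Cell v s
  | _ => c
  end.

Definition config := (cell * seq nat)%type.

Definition step (g : config) : option config :=
  let: (c, w) := g in
  if letter c is Some b then Some (next c, rcons w b) else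
  match c, w with
  | Cell [::] s, a :: w' =>
      if delta s a is Some (v, s') then Some (Cell v s', w') else None
  | _, _ => None
  end.

Fixpoint run n (g : config) : option config :=
  if n is m.+1 then obind (run m) (step g) else Some g.

Lemma run_add m n g : run (m + n) g = obind (run n) (run m g).
Proof. by elim: m g => //= m IH g; case: (step g) => //= g'; exact: IH. Qed.

Lemma runS n g : run n.+1 g = obind step (run n g).
Proof.
by rewrite -addn1 run_add; case: (run n g) => //= g'; case: (step g').
Qed.

Definition start n : config := (Inp n, [::]).

Definition diverges n := forall t, run t (start n) <> None.

Lemma run_push v s w : run (size v) (Cell v s, w) = Some (Cell [::] s, w ++ v).
Proof.
elim: v w => [|b v IH] w; first by rewrite cats0.
by rewrite /= IH cat_rcons.
Qed.

Lemma run_input n w :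
  run n.+1 (Inp n, w) = Some (Cell [::] s0, w ++ nseq n 1 ++ [:: 0]).
Proof.
elim: n w => [|n IH] w; first by rewrite /= cats1.
have -> : w ++ nseq n.+1 1 ++ [:: 0] = rcons w 1 ++ nseq n 1 ++ [:: 0].
  by rewrite cat_rcons.
exact: IH.
Qed.

Definition reach (g g' : config) := exists n, run n g = Some g'.
Definition reach1 (g g' : config) := exists n, run n.+1 g = Some g'.

Lemma reach_refl g : reach g g. Proof. by exists 0. Qed.

Lemma reach1W g g' : reach1 g g' -> reach g g'.
Proof. by case=> n; exists n.+1. Qed.

Lemma reach1_trans g1 g2 g3 : reach1 g1 g2 -> reach g2 g3 -> reach1 g1 g3.
Proof. by move=> [m E1] [n E2]; exists (m + n); rewrite -addSn run_add E1. Qed.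

Lemma reach_trans1 g1 g2 g3 : reach g1 g2 -> reach1 g2 g3 -> reach1 g1 g3.
Proof. by move=> [m E1] [n E2]; exists (m + n); rewrite -addnS run_add E1. Qed.

Lemma reach1_read s a w v s' : delta s a = Some (v, s') ->
  reach1 (Cell [::] s, a :: w) (Cell [::] s', w ++ v).
Proof. by move=> E; exists (size v); rewrite /= E /= run_push. Qed.

Lemma reach_rotate s u w : (forall x, x \in u -> delta s x = Some ([:: x], s)) ->
  reach (Cell [::] s, u ++ w) (Cell [::] s, w ++ u).
Proof.
elim: u w => [|x u IH] w Hu; first by rewrite cats0; exact: reach_refl.
have H1 := reach1_read (u ++ w) (Hu x (mem_head _ _)).
apply: reach1W; apply: reach1_trans H1 _.
rewrite -catA -(cat_rcons x w u) -cats1; apply: IH => y yu; apply: Hu.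
by rewrite inE yu orbT.
Qed.

(** Runs are closed under prefixes, so arbitrarily long ones suffice. *)
Lemma diverges_reach n : (forall m, exists2 t, m <= t & run t (start n) <> None) ->
  diverges n.
Proof.
move=> Hn m E; have [t /subnKC <-] := Hn m.
by rewrite run_add E.
Qed.

Definition halted (g : config) :=
  exists s a w, g = (Cell [::] s, a :: w) /\ delta s a = None.

Definition halts n := exists t g, run t (start n) = Some g /\ halted g.

(** * The formula *)

Inductive pvar :=
  | PInp of nat
  | PCell of seq nat & S
  | PLet of nat
  | PMatch of nat
  | PH
  | PNH
  | PFill of nat & S
  | PRead of nat & S
  | PNR.

(* The variables of input cells have odd indices, so that the formula describing
   the input can be written down without knowing the machine. *)
Variable cs : S -> nat.
Hypothesis cs_inj : injective cs.

Definition pvar_code (v : pvar) : nat :=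
  match v with
  | PInp k => k.*2.+1
  | PCell v s => (CodeSeq.code [:: 0; CodeSeq.code v; cs s]).*2
  | PLet b => (CodeSeq.code [:: 1; b]).*2
  | PMatch a => (CodeSeq.code [:: 2; a]).*2
  | PH => (CodeSeq.code [:: 3]).*2
  | PNH => (CodeSeq.code [:: 4]).*2
  | PFill a s => (CodeSeq.code [:: 5; a; cs s]).*2
  | PRead a s => (CodeSeq.code [:: 6; a; cs s]).*2
  | PNR => (CodeSeq.code [:: 7]).*2
  end.

Arguments pvar_code : simpl never.

Lemma pvar_code_inj : injective pvar_code.
Proof.
move=> [k|v s|b|a|||a s|a s|] [k'|v' s'|b'|a'|||a' s'|a' s'|] E;
  rewrite /pvar_code in E; try (by exfalso; lia); try by [].
all: try (move: E => /double_inj /code_inj; case=> // *; subst;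
         repeat match goal with
         | h : CodeSeq.code _ = CodeSeq.code _ |- _ => move/code_inj: h => ->
         | h : cs _ = cs _ |- _ => move/cs_inj: h => ->
         end; by []).
by case: E => /double_inj ->.
Qed.

Definition imp (l m : literal) : hs_horn := Clause [:: l] m.
Definition PVar (v : pvar) : literal := Var (pvar_code v).
Local Coercion PVar : pvar >-> literal.

Definition big_and (l : seq hs_horn) : hs_horn := foldr And (Lit Top) l.
Definition and_all A (l : seq A) (F : A -> hs_horn) : hs_horn :=
  big_and [seq F x | x <- l].

(* [PNH] and [PNR] stand for the negations of [PH] (match) and of [PRead]. *)
Definition match_rules : hs_horn := big_and
  [:: imp PH (Box RD PNH); imp PH (Box RB PNH); imp PH (Box RE PNH);
      Clause [:: PVar PH; PVar PNH] Bot;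
      imp (PInp 0) (PLet 0); imp (PInp 0) (Dia RA (PCell [::] s0))].

(** The two clauses after the first keep matches from ending where the cell ends, be it a match on
    the cell itself or a longer one. [RD] followed by [RA] or [RAbar] keeps matches from beginning
    or ending inside the cell. *)
Definition letter_rules b : hs_horn := big_and
  [:: imp (PLet b) (Dia RBbar (PMatch b)); imp (PLet b) PNH;
      imp (PLet b) (Box REbar PNH);
      imp (PLet b) (Box RD (Box RA PNH)); imp (PLet b) (Box RD (Box RAbar PNH));
      imp (PMatch b) PH].

(* [PRead] holds at a read cell if anywhere: [PNR] excludes the other intervals
   with the same left end. *)
Definition read_rules s : hs_horn := let R := PCell [::] s in big_and
  [:: imp R (Dia REbar PH); imp R (Box RBbar PNH);
      imp R (Box RD (Box RA PNH)); imp R (Box RD (Box RAbar PNH));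
      imp R (Box RB PNR); imp R (Box RBbar PNR)].

Definition push_rules v s : hs_horn :=
  if v is b :: v' then
    big_and [:: imp (PCell v s) (PLet b); imp (PCell v s) (Dia RA (PCell v' s))]
  else Lit Top.

(** The conclusion of the fill clause opens with [Box RA] because its antecedent holds vacuously at
    a last point, where nothing may be demanded; [RAbar] and [RA] then lead back to the point and on
    to the read cell. *)
Definition step_rules (strict : bool) a s : hs_horn := big_and
  [:: imp (PCell [::] s) (Box RB (PFill a s));
      imp (PCell [::] s) (Box RBbar (PFill a s));
      imp (PMatch a) (Box RE (PFill a s));
      imp (Box RA (PFill a s)) (Box RA (Dia RAbar (Dia RA (PRead a s))));
      Clause [:: PVar (PRead a s); PVar PNR] Bot;
      if delta s a is Some (v, s') then imp (PRead a s) (Dia RA (PCell v s'))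
      else if strict then imp (PRead a s) Bot else Lit Top].

(** A step pushes at most two letters, so these are the nonempty words that can label a [Cell]. *)
Definition words N : seq (seq nat) :=
  [seq [:: a] | a <- iota 0 N] ++
  [seq [:: a; b] | a <- iota 0 N, b <- iota 0 N].

(** The first two conjuncts concern the initial interval: it is not punctual, and no match contains
    it in its interior. *)
Definition base strict N (L : seq S) : hs_horn := big_and
  [:: Lit (Dia RB Top); Lit (Box RDbar PNH); match_rules;
      and_all (iota 0 N) letter_rules;
      and_all L read_rules;
      and_all (words N) (fun v => and_all L (push_rules v));
      and_all (iota 0 N) (fun a => and_all L (step_rules strict a))].

(** The clauses for [PInp 0] name the initial state and so belong to [match_rules]; the clauses here
    are common to all machines. *)
Fixpoint input_rules k : hs_horn :=
  if k is k'.+1 then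
    And (And (imp (PInp k) (PLet 1)) (imp (PInp k) (Dia RA (PInp k'))))
        (input_rules k')
  else Lit Top.

Definition init n : hs_horn := And (Lit (PInp n)) (input_rules n).

Lemma and_all_core A (l : seq A) F :
  (forall x, is_core (F x)) -> is_core (and_all l F).
Proof. by move=> H; rewrite /and_all; elim: l => //= x l ->; rewrite H. Qed.

Lemma base_core strict N L : is_core (base strict N L).
Proof.
rewrite /base /= !andbT !and_all_core //= => [a|v].
  apply: and_all_core => s; rewrite /step_rules /=.
  by case: (delta s a) => [[v s']|] //=; case: strict.
by apply: and_all_core => s; case: v.
Qed.

Lemma init_core n : is_core (init n).
Proof. by rewrite /init /=; elim: n. Qed.

(** * From models to runs *)

Section Soundness.

Variables (d : Order.disp_t) (T : orderType d) (V : nat -> set (ival T)).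
Variables (i0 : ival T) (strict : bool) (N : nat) (L : seq S) (n : nat).
Hypothesis base_i0 : holds V i0 (base strict N L).
Hypothesis init_i0 : holds V i0 (init n).
Hypothesis N1 : 1 < N.
Hypothesis L0 : List.In s0 L.
Hypothesis delta_closed : forall s a v s', List.In s L -> a < N ->
  delta s a = Some (v, s') ->
  [/\ List.In s' L, all (gtn N) v & size v <= 2].

(** Intervals carry a proof that their ends are ordered; quantifying over it lets the ends be
    rewritten. *)
Definition On (p : pvar) (x y : T) : Prop :=
  exists e : (x <= y)%O, V (pvar_code p) (Ival e).

Lemma On_ival p (j : ival T) : On p (lo j) (hi j) <-> V (pvar_code p) j.
Proof.
split; case: j => x y e /=; last by exists e.
by case=> e'; rewrite (bool_irrelevance e' e).
Qed.

Lemma On_le p x y : On p x y -> (x <= y)%O.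
Proof. by case. Qed.

Lemma holds_and_all A (l : seq A) F x :
  holds V i0 (and_all l F) -> List.In x l -> holds V i0 (F x).
Proof. by elim: l => //= y l IH [Hy Hl] [<- //|]; exact: IH. Qed.

Lemma imp_elim p l x y : holds V i0 (imp (PVar p) l) ->
  On p x y -> exists e : (x <= y)%O, lit_holds V (Ival e) l.
Proof. by move=> Hp [e He]; exists e; apply: Hp; constructor. Qed.

Lemma dia_elim p R q x y : holds V i0 (imp (PVar p) (Dia R (PVar q))) ->
  On p x y -> exists (e : (x <= y)%O) (j : ival T),
    rel_sem R (Ival e) j /\ On q (lo j) (hi j).
Proof.
move=> Hp /(imp_elim Hp) [e /= [j [Rj Hj]]]; exists e, j; split=> //.
exact/On_ival.
Qed.

Lemma box_elim p R q x y x2 y2 : holds V i0 (imp (PVar p) (Box R (PVar q))) ->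
  On p x y -> (x2 <= y2)%O ->
  (forall (e : (x <= y)%O) (e2 : (x2 <= y2)%O), rel_sem R (Ival e) (Ival e2)) ->
  On q x2 y2.
Proof.
move=> Hp /(imp_elim Hp) [e /= Hb] e2 Rj; exists e2; exact: Hb.
Qed.

Lemma bot_elim p q x y : holds V i0 (Clause [:: PVar p; PVar q] Bot) ->
  On p x y -> On q x y -> False.
Proof.
move=> Hb [e He] [e' He']; apply: (Hb (Ival e)); constructor=> //.
by constructor=> //=; rewrite (bool_irrelevance e e').
Qed.

Lemma In_iota a : a < N -> List.In a (iota 0 N).
Proof.
move=> aN; have : a \in iota 0 N by rewrite mem_iota.
by elim: (iota 0 N) => //= b l IH; rewrite inE => /orP[/eqP->|/IH]; [left|right].
Qed.

Definition good (c : cell) : Prop :=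
  match c with
  | Inp k => k <= n
  | Cell v s => [/\ List.In s L, all (gtn N) v & size v <= 2]
  | _ => False
  end.

Definition cellvar (c : cell) : pvar :=
  match c with Inp k => PInp k | Cell v s => PCell v s | _ => PH end.

Let letterR b : b < N -> holds V i0 (letter_rules b).
Proof.
move=> bN; case: base_i0 => _ [_ [_ [Hl _]]].
exact: holds_and_all Hl (In_iota bN).
Qed.

Let readR s : List.In s L -> holds V i0 (read_rules s).
Proof.
by move=> sL; case: base_i0 => _ [_ [_ [_ [Hl _]]]]; exact: holds_and_all Hl sL.
Qed.

Let stepR a s : a < N -> List.In s L -> holds V i0 (step_rules strict a s).
Proof.
move=> aN sL; case: base_i0 => _ [_ [_ [_ [_ [_ [Hl _]]]]]].
exact: holds_and_all (holds_and_all Hl (In_iota aN)) sL.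
Qed.

Let matchR : holds V i0 match_rules.
Proof. by case: base_i0 => _ [_ []]. Qed.

Lemma In_words b v : size v < 2 -> b < N -> all (gtn N) v ->
  List.In (b :: v) (words N).
Proof.
move=> sv bN vN; apply/In_cat.
case: v sv vN => [|a [|//]] _ /=.
  by move=> _; left; exact: (@In_map _ _ (fun a => [:: a])) (In_iota bN).
rewrite andbT => aN; right.
exact: (@In_allpairs _ _ _ (fun a b => [:: a; b])) (In_iota bN) (In_iota aN).
Qed.

Lemma good_letter c b x y : good c -> letter c = Some b -> On (cellvar c) x y ->
  [/\ b < N, On (PLet b) x y, good (next c) &
      exists z, (y < z)%O /\ On (cellvar (next c)) y z].
Proof.
have [_ [_ [_ [_ [m5 [m6 _]]]]]] := matchR.
have inp k : k <= n -> holds V i0 (input_rules k).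
  case: init_i0 => _ /=; elim: n => [|m IH] Hm; first by rewrite leqn0 => /eqP->.
  rewrite leq_eqVlt => /orP[/eqP-> //|]; apply: IH; exact: (proj2 Hm).
case: c => [[|k]|[|a v] s||] //=.
- move=> _ [<-] Hc; split=> //; first exact: ltnW.
  + by have [e He] := imp_elim m5 Hc; exists e.
  + have [e [j [[/= -> lj] Hj]]] := dia_elim m6 Hc.
    by exists (hi j).
- move=> kn [<-] Hc; have [[r1 r2] _] := inp _ kn; split=> //.
  + by have [e He] := imp_elim r1 Hc; exists e.
  + exact: ltnW.
  + have [e [j [[/= -> lj] Hj]]] := dia_elim r2 Hc.
    by exists (hi j).
- move=> [sL /andP[aN vN] sv] [<-] Hc.
  have [_ [_ [_ [_ [_ [Hl _]]]]]] := base_i0.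
  have [r1 [r2 _]] := holds_and_all (holds_and_all Hl (In_words sv aN vN)) sL.
  split=> //.
  + by have [e He] := imp_elim r1 Hc; exists e.
  + by split=> //; exact: ltnW.
  + have [e [j [[/= -> lj] Hj]]] := dia_elim r2 Hc.
    by exists (hi j).
Qed.

Definition no_inside (x y : T) := forall z w, (x < z)%O -> (z < y)%O ->
  ((z < w)%O -> ~ On PH z w) /\ ((w < z)%O -> ~ On PH w z).

(** The punctual interval at [z] is an [RD]-successor of the cell, and the intervals beginning or
    ending at [z] are its successors by [RA] and [RAbar]. *)
Lemma no_inside_elim p x y :
  holds V i0 (imp (PVar p) (Box RD (Box RA (PVar PNH)))) ->
  holds V i0 (imp (PVar p) (Box RD (Box RAbar (PVar PNH)))) ->
  On p x y -> no_inside x y.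
Proof.
have [_ [_ [_ [m4 _]]]] := matchR.
move=> r1 r2 Hp z w xz zy; split=> zw Hz; apply: (bot_elim m4 Hz).
  have [e /= /(_ (Ival (lexx z)) (conj xz zy) (Ival (ltW zw)))] := imp_elim r1 Hp.
  by move=> /(_ (conj erefl zw)) ?; exists (ltW zw).
have [e /= /(_ (Ival (lexx z)) (conj xz zy) (Ival (ltW zw)))] := imp_elim r2 Hp.
by move=> /(_ (conj erefl zw)) ?; exists (ltW zw).
Qed.

Lemma PH_sub x y x2 y2 : On PH x y -> On PH x2 y2 ->
  ~ [/\ (x < x2)%O, (x2 <= y2)%O & (y2 < y)%O] /\
  ~ (x = x2 /\ (y2 < y)%O) /\ ~ ((x < x2)%O /\ y = y2).
Proof.
have [m1 [m2 [m3 [m4 _]]]] := matchR.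
move=> H1 H2; have [e2 _] := H2.
split; [|split]; move=> C; apply: (bot_elim m4 H2).
- by case: C => ? ? ?; apply: (box_elim m1 H1).
- by apply: (box_elim m2 H1).
- by apply: (box_elim m3 H1).
Qed.

Lemma letter_facts b x y : b < N -> On (PLet b) x y ->
  [/\ no_inside x y, exists z, (y < z)%O /\ On (PMatch b) x z
    & forall z, (z <= x)%O -> ~ On PH z y].
Proof.
have [_ [_ [_ [m4 _]]]] := matchR.
move=> bN Hb; have [r1 [r2 [r3 [r4 [r5 _]]]]] := letterR bN.
have xy := On_le Hb; split.
- exact: no_inside_elim r4 r5 Hb.
- have [e [j [[/= -> yj] Hj]]] := dia_elim r1 Hb.
  by exists (hi j).
- move=> z; rewrite le_eqVlt => /orP[/eqP->|zx] Hz; apply: (bot_elim m4 Hz).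
    by have [e He] := imp_elim r2 Hb; exists e.
  by apply: (box_elim r3 Hb) => //; exact: le_trans (ltW zx) xy.
Qed.

(* [inv g x y pend]: (x, y) is the cell of the configuration g and pend lists the
   left ends of the letter cells in the queue. The last two clauses say that the
   matches crossing x are those of the pending letters. *)
Record inv (g : config) (x y : T) (pend : seq (T * nat)) : Prop := Inv {
  inv_good : good g.1;
  inv_cell : On (cellvar g.1) x y;
  inv_lt : (x < y)%O;
  inv_queue : [seq e.2 | e <- pend] = g.2;
  inv_letters : all (gtn N) g.2;
  inv_sorted : sorted <%O [seq e.1 | e <- pend];
  inv_pend : forall e, e \in pend ->
    (e.1 < x)%O /\ exists z, (e.1 < z)%O /\ On (PMatch e.2) e.1 z;
  inv_start : forall z w, (z < x)%O -> (x < w)%O -> On PH z w ->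
    z \in [seq e.1 | e <- pend];
  inv_end : forall z w, z \in [seq e.1 | e <- pend] -> (z < w)%O ->
    On PH z w -> (x < w)%O }.

Lemma match_PH a x y : a < N -> On (PMatch a) x y -> On PH x y.
Proof.
move=> aN Ha; have [_ [_ [_ [_ [_ [r _]]]]]] := letterR aN.
by have [e He] := imp_elim r Ha; exists e.
Qed.

(* First in, first out: the head of the queue is matched to the current read
   cell, since otherwise its match and that of the read cell would be nested. *)
Lemma inv_match s a w x y X pend :
  inv (Cell [::] s, a :: w) x y ((X, a) :: pend) -> On (PMatch a) X y.
Proof.
case=> /= -[sL _ _] Hc xy [Eq] /andP[aN _] Hs Hp Hst Hen.
have [r1 [r2 [r3 [r4 [r5 _]]]]] := readR sL.
have ni := no_inside_elim r3 r4 Hc.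
have [Xx [z [Xz Hz]]] := Hp (X, a) (mem_head _ _); rewrite /= in Xx Xz Hz.
have HXz := match_PH aN Hz.
have xz : (x < z)%O by apply: Hen HXz => //; exact: mem_head.
have [e [j [[/= jx yj] Hj]]] := dia_elim r1 Hc.
rewrite -yj in Hj; have := Hst _ _ jx xy Hj; rewrite inE => jX.
(* The match of [X] cannot end inside the read cell. If it ended beyond [y], the match ending at
   [y], which begins at [X] or at a later pending letter, would be nested in it. *)
case: (ltgtP z y) => [zy|yz|<- //]; first by case: (ni z X xz zy) => _ /(_ Xz).
have [n1 [n2 _]] := PH_sub HXz Hj.
case/orP: jX => [/eqP E|jX]; first by case: n2.
case: n1; split=> //; last exact: On_le Hj.
by have := order_path_min (@lt_trans _ _) Hs => /allP; apply.
Qed.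

(** All nonpunctual intervals beginning at [x] are filled: the read cell by the match that ends with
    it, the others by the state. The resulting [PRead] begins at [x], and [PNR] leaves only the cell
    itself as its place. *)
Lemma inv_read s a w x y X pend :
  inv (Cell [::] s, a :: w) x y ((X, a) :: pend) -> On (PRead a s) x y.
Proof.
move=> I; have HX := inv_match I.
case: I => /= -[sL _ _] Hc xy [Eq] /andP[aN _] Hs Hp Hst Hen.
have [_ [_ [_ [_ [r5 [r6 _]]]]]] := readR sL.
have [f1 [f2 [f3 [f4 [f5 _]]]]] := stepR aN sL.
have [Xx _] := Hp (X, a) (mem_head _ _); rewrite /= in Xx.
have fill : lit_holds V (Ival (lexx x)) (Box RA (PVar (PFill a s))).
  move=> j [/= jx]; rewrite -jx => xz; apply/On_ival; rewrite -jx.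
  move: (hi j) xz => z xz {j jx}.
  case: (ltgtP z y) => [zy|yz|->].
  - by apply: (box_elim f1 Hc) => //; exact: ltW.
  - by apply: (box_elim f2 Hc) => //; exact: ltW.
  - by apply: (box_elim f3 HX) => //; exact: ltW.
have /= := f4 (Ival (lexx x)) (List.Forall_cons _ fill (List.Forall_nil _)).
move=> /(_ (Ival (ltW xy)) (conj erefl xy)) [j1 [/= [yj1 _] [j2 [[E lj] Hj]]]].
have {}Hj : On (PRead a s) x (hi j2) by rewrite -yj1 E; apply/On_ival.
case: (ltgtP (hi j2) y) => [jy|yj|<- //]; case: (bot_elim f5 Hj).
- by apply: (box_elim r5 Hc) => //; exact: On_le Hj.
- by apply: (box_elim r6 Hc) => //; exact: On_le Hj.
Qed.

Lemma sorted_rcons_lt (s : seq T) x :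
  sorted <%O s -> (forall z, z \in s -> (z < x)%O) -> sorted <%O (rcons s x).
Proof.
case: s => //= y s; rewrite rcons_path => -> /=; apply.
by rewrite mem_last.
Qed.

(** A letter cell adds its left end to the pending points, a read cell removes the oldest. The
    clauses on crossing matches persist because no match has an end inside a cell, none ends with a
    letter cell, and none is nested in another. *)
Lemma inv_step g g' x y pend : inv g x y pend -> step g = Some g' ->
  exists z pend', inv g' y z pend'.
Proof.
case: g => c w I; rewrite /step.
case Ec : (letter c) => [b|].
  case: I => /= gc Hc xy Eq wN Hs Hp Hst Hen [<-].
  have [bN Hb gn [z [yz Hn]]] := good_letter gc Ec Hc.
  have [ni [z' [yz' Hz']] ne] := letter_facts bN Hb.
  exists z, (rcons pend (x, b)); split=> //=.
  - by rewrite map_rcons Eq.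
  - by rewrite all_rcons /= bN.
  - rewrite map_rcons; apply: sorted_rcons_lt => // _ /mapP[e /Hp[? _] ->] //.
  - move=> e; rewrite mem_rcons inE => /orP[/eqP->|/Hp[ex ?]] /=.
      by split=> //; exists z'; split=> //; exact: lt_trans xy yz'.
    by split=> //; exact: lt_trans ex xy.
  - move=> u v uy yv Hu; rewrite map_rcons mem_rcons inE /=.
    case: (ltgtP u x) => //= [ux|xu]; first exact: Hst ux (lt_trans xy yv) Hu.
    by case: (ni u v xu uy) => /(_ (lt_trans uy yv)).
  - move=> u v; rewrite map_rcons mem_rcons inE /= => Hu uv Huv.
    have [ux xv] : (u <= x)%O /\ (x < v)%O.
      case/orP: Hu => [/eqP ux|Hu]; first by rewrite -ux.
      split; last exact: Hen Huv.
      by case/mapP: Hu => e /Hp[/ltW ? _] ->.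
    case: (ltgtP v y) => // [vy|vy]; last by case: (ne u ux); rewrite -vy.
    by case: (ni v u xv vy) => _ /(_ uv).
case: c Ec I => [[|k]|[|//] s||] // _; case: w => // a w I.
case Ed : (delta s a) => [[v s']|] // [<-].
case: pend I => [|[X a'] pend] I; first by case: I.
have /= [E1 Eq] := inv_queue I; rewrite E1 {a' E1} in I.
have HX := inv_match I; have HR := inv_read I.
case: I => /= -[sL _ _] Hc xy _ /andP[aN wN] Hs Hp Hst Hen.
have [r1 [r2 [r3 [r4 [r5 _]]]]] := readR sL.
have ni := no_inside_elim r3 r4 Hc.
have [sL' vN sv] := delta_closed sL aN Ed.
have [_ [_ [_ [_ [_ [f6 _]]]]]] := stepR aN sL; rewrite Ed in f6.
have [e [j [[/= <- yj] Hj]]] := dia_elim f6 HR.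
have HXy := match_PH aN HX.
have Xp : forall z, z \in [seq e.1 | e <- pend] -> (X < z)%O.
  by move: Hs => /(order_path_min (@lt_trans _ _)) /allP.
have px : forall z, z \in [seq e.1 | e <- pend] -> (z < x)%O.
  by move=> _ /mapP[u Hu ->]; case: (Hp u) => //; rewrite inE Hu orbT.
exists (hi j), pend; split=> //=.
- exact: path_sorted Hs.
- move=> u Hu; case: (Hp u); first by rewrite inE Hu orbT.
  by move=> ux ?; split=> //; exact: lt_trans ux xy.
(* A match crossing [y] from [X] would properly extend the one ending at [y]; the read rules forbid
   one from [x] or from inside the cell. *)
- move=> u v' uy yv Hu; case: (ltgtP u x) => [ux|xu|E].
  + have := Hst _ _ ux (lt_trans xy yv) Hu; rewrite inE => /orP[/eqP E|//].
    by case: (PH_sub Hu HXy) => _ [[]].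
  + by case: (ni u v' xu uy) => /(_ (lt_trans uy yv)).
  + have [_ [_ [_ [m4 _]]]] := matchR.
    case: (bot_elim m4 Hu); rewrite E.
    by apply: (box_elim r2 Hc) => //; apply: ltW; exact: lt_trans xy yv.
- move=> u v' Hu uv Huv.
  have xv : (x < v')%O by apply: Hen Huv => //; rewrite inE Hu orbT.
  case: (ltgtP v' y) => // [vy|E].
    by case: (ni v' u xv vy) => _ /(_ uv).
  by case: (PH_sub HXy Huv) => _ [_ []]; rewrite E Xp.
Qed.

(** With nothing pending, no match may cross the left end of the initial interval: the letter rules
    exclude an end inside it or at [hi i0], and [Box RDbar PNH] excludes one beyond. *)
Lemma inv_init : inv (start n) (lo i0) (hi i0) [::].
Proof.
have [Hb [Hd _]] := base_i0; have [Hi _] := init_i0.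
have Hc : On (cellvar (Inp n)) (lo i0) (hi i0) by apply/On_ival.
have xy : (lo i0 < hi i0)%O.
  case: Hb => j [/= [-> jh] _]; exact: le_lt_trans (lo_le_hi j) jh.
have [b Eb] : exists b, letter (Inp n) = Some b.
  by case: (n) => [|k]; eexists.
have [bN Hl _ _] := good_letter (leqnn _ : good (Inp n)) Eb Hc.
have [ni _ ne] := letter_facts bN Hl.
split=> //= z w zx xw Hz; case: (ltgtP w (hi i0)) => [wy|yw|E].
- by case: (ni w z xw wy) => _ /(_ (lt_trans zx xw)).
- have zw := On_le Hz; have [_ [_ [_ [m4 _]]]] := matchR.
  case: (bot_elim m4 Hz); exists zw.
  exact: (Hd (Ival zw)).
- by case: (ne z (ltW zx)); rewrite -E.
Qed.

(** The decreasing list of the left ends of past cells shows that a run of [t] steps uses more than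
    [t] points, which bounds runs in finite orders. *)
Lemma inv_run t g : run t (start n) = Some g -> exists x y pend (l : seq T),
  [/\ inv g x y pend, size l = t & path >%O x l].
Proof.
elim: t g => [|t IH] g.
  case=> <-; exists (lo i0), (hi i0), [::], [::].
  by split=> //; exact: inv_init.
rewrite runS; case E : (run t _) => [g0|] //= E'.
have [x [y [pend [l [I sl pl]]]]] := IH _ E.
have [z [pend' I']] := inv_step I E'.
exists y, z, pend', (x :: l); split=> //; first by rewrite /= sl.
by rewrite /= (inv_lt I).
Qed.

Lemma strict_not_halts : strict -> ~ halts n.
Proof.
move=> st [t [g [/inv_run [x [y [pend [l [I _ _]]]]] [s [a [w [Eg Ed]]]]]]].
rewrite {}Eg in I.
case: pend I => [|[X a'] pend] I; first by case: I.
have /= [E1 Eq] := inv_queue I; rewrite E1 {a' E1} in I.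
have [e He] := inv_read I.
case: (inv_good I) => /= sL _ _; have /= /andP[aN _] := inv_letters I.
have [_ [_ [_ [_ [_ [f6 _]]]]]] := stepR aN sL.
by rewrite Ed st in f6; apply: (f6 (Ival e)); constructor.
Qed.

Lemma finite_not_diverges : Fin T -> ~ diverges n.
Proof.
move=> /finite_seqP [s Es] dv.
have [g Eg] : exists g, run (size s).+1 (start n) = Some g.
  by case E : (run _ _) => [g|]; [exists g|case: (dv _ E)].
have [x [_ [_ [l [_ sl pl]]]]] := inv_run Eg.
have ul : uniq l.
  move/path_sorted: pl; rewrite -rev_uniq -rev_sorted; exact: lt_sorted_uniq.
have ls : {subset l <= s}.
  by move=> z _; have : [set: T]%classic z by []; rewrite Es.
by have := uniq_leq_size ul ls; rewrite sl ltnn.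
Qed.

End Soundness.

(** * From runs to models *)

Section Generator.

Variable n : nat.

(* The queue holds pairs (index of the cell, letter). A halted machine flushes
   its queue through [Junk] cells, so that every letter is eventually read. *)
Definition gnext i (g : cell * seq (nat * nat)) : cell * seq (nat * nat) :=
  let: (c, q) := g in
  if letter c is Some b then (next c, rcons q (i, b)) else
  match c, q with
  | Cell _ s, (_, a) :: q' =>
      if delta s a is Some (v, s') then (Cell v s', q') else (Junk, q')
  | Junk, _ :: q' => (Junk, q')
  | _, _ => (Blank, q)
  end.

Fixpoint gen i := if i is j.+1 then gnext j (gen j) else (Inp n, [::]).

Definition lab i : cell := (gen i).1.

Definition reads (c : cell) : bool :=
  match c with Cell [::] _ | Junk => true | _ => false end.

Definition matched k a i : Prop :=
  reads (lab i) /\ ohead (gen i).2 = Some (k, a).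

Lemma reads_letter c : reads c -> letter c = None.
Proof. by case: c => [[]|[]||]. Qed.

Lemma gen_letter i b : letter (lab i) = Some b ->
  gen i.+1 = (next (lab i), rcons (gen i).2 (i, b)).
Proof. by rewrite /lab /=; case: (gen i) => c q /= ->. Qed.

Lemma lab_next i b : letter (lab i) = Some b -> lab i.+1 = next (lab i).
Proof. by rewrite {2}/lab => /gen_letter ->. Qed.

Lemma gen_read i : reads (lab i) -> (gen i.+1).2 = behead (gen i).2.
Proof.
rewrite /lab /=; case: (gen i) => c q /=.
case: c => [[]|[|//] s||] //= _; case: q => [|[k a] q] //=.
by case: (delta s a) => [[]|].
Qed.

Lemma gen_blank i : letter (lab i) = None -> ~~ reads (lab i) ->
  lab i = Blank /\ gen i.+1 = gen i.
Proof. by rewrite /lab /=; case: (gen i) => [[[]|[]||]] /=. Qed.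

Lemma gen_mem i e : e \in (gen i).2 -> e.1 < i /\ letter (lab e.1) = Some e.2.
Proof.
elim: i => [|i IH] //; case Eb : (letter (lab i)) => [b|].
  rewrite (gen_letter Eb) mem_rcons inE => /orP[/eqP->|/IH[ei ?]] //.
  by split=> //; exact: ltnW.
case R : (reads (lab i)); last first.
  by have [_ ->] := gen_blank Eb (negbT R); move=> /IH [? ?]; split=> //; exact: ltnW.
by rewrite gen_read // => /mem_behead /IH [? ?]; split=> //; exact: ltnW.
Qed.

Lemma gen_sorted i : sorted ltn [seq e.1 | e <- (gen i).2].
Proof.
elim: i => [|i IH] //; case Eb : (letter (lab i)) => [b|].
  rewrite (gen_letter Eb) map_rcons /=.
  case Eq : (gen i).2 IH => [|e q] //= IH; rewrite rcons_path IH /=.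
  suff /mapP[e' He' ->] : last e.1 [seq e.1 | e <- q] \in [seq e.1 | e <- (gen i).2].
    by case: (gen_mem He').
  by rewrite Eq /= mem_last.
case R : (reads (lab i)); last by have [_ ->] := gen_blank Eb (negbT R).
rewrite gen_read //; case: (gen i).2 IH => //= e q; exact: path_sorted.
Qed.

Lemma matched_mem k a i : matched k a i -> (k, a) \in (gen i).2.
Proof. by case=> _; case: (gen i).2 => //= e q [->]; exact: mem_head. Qed.

Lemma matched_lt k a i : matched k a i -> k < i.
Proof. by move/matched_mem/gen_mem => []. Qed.

Lemma matched_letter k a i : matched k a i -> letter (lab k) = Some a.
Proof. by move/matched_mem/gen_mem => []. Qed.

(** The queue is sorted by age and only newer cells enter it, so everything left after [k] was
    popped is younger than [k]. *)
Lemma matched_low k a i j e : matched k a i -> i < j -> e \in (gen j).2 -> k < e.1.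
Proof.
move=> M; elim: j e => [|j IH] e //; rewrite ltnS leq_eqVlt => /orP[/eqP<-|ij].
  case: (M) => R; rewrite gen_read //; have := gen_sorted i.
  case: (gen i).2 => //= e' q /(order_path_min ltn_trans) /allP qk [E] eq.
  by rewrite E in qk; apply: qk; exact: map_f.
have kj := ltn_trans (matched_lt M) ij.
case Eb : (letter (lab j)) => [b|].
  by rewrite (gen_letter Eb) mem_rcons inE => /orP[/eqP->|/(IH _ ij)].
case R : (reads (lab j)); last first.
  by have [_ ->] := gen_blank Eb (negbT R); exact: IH.
by rewrite gen_read // => /mem_behead /(IH _ ij).
Qed.

Lemma matched_mono k a i k' a' i' :
  matched k a i -> matched k' a' i' -> i < i' -> k < k'.
Proof. by move=> M /matched_mem M' ii'; exact: matched_low M ii' M'. Qed.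

Lemma matched_inj k a k' a' i : matched k a i -> matched k' a' i -> k = k' /\ a = a'.
Proof. by case=> _ + [_]; move=> -> []. Qed.

(** The number of letter cells from this one up to the next read, a measure that every push
    decreases. *)
Definition rank (c : cell) :=
  match c with Inp k => k.+1 | Cell v _ => size v | _ => 0 end.

Lemma rank_next c b : letter c = Some b -> rank (next c) < rank c.
Proof. by case: c => [[]|[]||] //=. Qed.

Lemma gen_blank_nil i : lab i = Blank -> (gen i).2 = [::].
Proof.
elim: i => [|i IH] //=; rewrite /lab /= -/(lab i); move: IH; rewrite /lab.
case: (gen i) => -[[]|[|? ?] s||] q //= IH; case: q IH => [|[k a] q] //=.
by case: (delta s a) => [[]|].
Qed.

(** Lexicographic induction on the position in the queue and the rank: a push keeps the position and
    lowers the rank, a read lowers the position. Blank cells do not occur before the queue is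
    empty. *)
Lemma matched_ex i e : e \in (gen i).2 -> exists2 j, i <= j & matched e.1 e.2 j.
Proof.
move Em : (index e (gen i).2) => m; elim: m i Em => [|m IHm] i;
  (move Er : (rank (lab i)) => r; elim/ltn_ind: r i Er => r IHr i Er Em He);
  case Eb : (letter (lab i)) => [b|].
- have [| | |j ij Hj] := IHr _ _ i.+1 erefl.
  + by rewrite -Er /lab (gen_letter Eb); exact: rank_next Eb.
  + by rewrite (gen_letter Eb) /= -cats1 index_cat He.
  + by rewrite (gen_letter Eb) mem_rcons inE He orbT.
  + by exists j => //; exact: ltnW.
- case R : (reads (lab i)).
    exists i => //; split=> //.
    case: (gen i).2 Em He => //= e' q; case: eqP => // -> _ _.
    by rewrite -surjective_pairing.
  by have [/gen_blank_nil E _] := gen_blank Eb (negbT R); rewrite E in He.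
- have [| | |j ij Hj] := IHr _ _ i.+1 erefl.
  + by rewrite -Er /lab (gen_letter Eb); exact: rank_next Eb.
  + by rewrite (gen_letter Eb) /= -cats1 index_cat He.
  + by rewrite (gen_letter Eb) mem_rcons inE He orbT.
  + by exists j => //; exact: ltnW.
- case R : (reads (lab i)); last first.
    by have [/gen_blank_nil E _] := gen_blank Eb (negbT R); rewrite E in He.
  have [| |j ij Hj] := IHm i.+1.
  + rewrite gen_read //; case: (gen i).2 Em => //= e' q.
    by case: eqP => // _ [].
  + rewrite gen_read //; case: (gen i).2 Em He => //= e' q.
    by rewrite inE eq_sym; case: eqP.
  + by exists j => //; exact: ltnW.
Qed.

(* Only the points [p i] with [U i] are meaningful: all of them for an
   infinite run, finitely many for a halting one. *)
Section Model.

Variables (d : Order.disp_t) (T : orderType d) (strict : bool).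
Variables (U : nat -> Prop) (p : nat -> T).
Hypothesis U_down : forall i j, i <= j -> U j -> U i.
Hypothesis U_lab : forall i, lab i <> Blank -> U i.+1.
Hypothesis p_mono : forall i j, U j -> i < j -> (p i < p j)%O.
(** At [w] no match begun before [y] ends, so the interval from [y] to [w] can be filled only by a
    state whose read cell begins at [y]. *)
Hypothesis hole : forall y z : T, (y < z)%O -> exists2 w, (y < w)%O &
  forall k a i, matched k a i -> w = p i.+1 -> (y <= p k)%O.
Hypothesis nonempty : forall i s, lab i = Cell [::] s -> (gen i).2 <> [::].
Hypothesis strict_run : strict -> forall i s k a q,
  gen i = (Cell [::] s, (k, a) :: q) -> delta s a <> None.

Lemma p_lt i j : U i -> U j -> (p i < p j)%O = (i < j).
Proof.
move=> Ui Uj; case: (ltngtP i j) => [ij|ji|->]; last by rewrite ltxx.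
  exact: p_mono.
by apply/negbTE; rewrite -leNgt; apply/ltW; exact: p_mono.
Qed.

Lemma p_inj i j : U i -> U j -> p i = p j -> i = j.
Proof.
move=> Ui Uj E; have := p_lt Ui Uj; have := p_lt Uj Ui; rewrite E ltxx.
by case: ltngtP.
Qed.

(** [PNH] and [PNR] are exact complements, so that clauses concluding them become statements about
    where matches and read cells lie. *)
Definition Val (v : pvar) (x y : T) : Prop :=
  match v with
  | PInp k => exists i, [/\ lab i = Inp k, x = p i & y = p i.+1]
  | PCell v s => exists i, [/\ lab i = Cell v s, x = p i & y = p i.+1]
  | PLet b => exists i, [/\ letter (lab i) = Some b, x = p i & y = p i.+1]
  | PMatch a => exists k i, [/\ matched k a i, x = p k & y = p i.+1]
  | PH => exists a k i, [/\ matched k a i, x = p k & y = p i.+1]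
  | PNH => ~ exists a k i, [/\ matched k a i, x = p k & y = p i.+1]
  | PFill a s =>
      (exists i, [/\ lab i = Cell [::] s, x = p i & y <> p i.+1]) \/
      (exists k i, [/\ matched k a i, (p k < x)%O & y = p i.+1])
  | PRead a s =>
      exists k i, [/\ lab i = Cell [::] s, matched k a i, x = p i & y = p i.+1]
  | PNR => ~ exists a s k i,
      [/\ lab i = Cell [::] s, matched k a i, x = p i & y = p i.+1]
  end.

Definition valuation (m : nat) (j : ival T) : Prop :=
  exists2 v, pvar_code v = m & Val v (lo j) (hi j).

Lemma valuationE v j : lit_holds valuation j (PVar v) <-> Val v (lo j) (hi j).
Proof. by split=> [[u /pvar_code_inj ->]|]; last exists v. Qed.

Lemma holds_imp i v l :
  (forall j, Val v (lo j) (hi j) -> lit_holds valuation j l) ->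
  holds valuation i (imp (PVar v) l).
Proof.
move=> Hl j Hj.
by have /valuationE /Hl : lit_holds valuation j (PVar v) := List.Forall_inv Hj.
Qed.

Lemma holds_bot i u v :
  (forall x y, Val u x y -> Val v x y -> False) ->
  holds valuation i (Clause [:: PVar u; PVar v] Bot).
Proof.
move=> Hl j Hj; apply: (Hl (lo j) (hi j)); apply/valuationE.
  exact: List.Forall_inv Hj.
exact: List.Forall_inv (List.Forall_inv_tail Hj).
Qed.

Lemma imp_box i u R v :
  (forall x y x2 y2 (e : (x <= y)%O) (e2 : (x2 <= y2)%O), Val u x y ->
     rel_sem R (Ival e) (Ival e2) -> Val v x2 y2) ->
  holds valuation i (imp (PVar u) (Box R (PVar v))).
Proof.
move=> Hl; apply: holds_imp => -[x y e] /= Hu [x2 y2 e2] HR.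
by apply/valuationE; exact: Hl Hu HR.
Qed.

Lemma imp_dia i u R v :
  (forall x y (e : (x <= y)%O), Val u x y -> exists x2 y2 (e2 : (x2 <= y2)%O),
     rel_sem R (Ival e) (Ival e2) /\ Val v x2 y2) ->
  holds valuation i (imp (PVar u) (Dia R (PVar v))).
Proof.
move=> Hl; apply: holds_imp => -[x y e] /= Hu.
have [x2 [y2 [e2 [HR Hv]]]] := Hl _ _ e Hu.
by exists (Ival e2); split=> //; apply/valuationE.
Qed.

Lemma imp_var i u v : (forall x y, Val u x y -> Val v x y) ->
  holds valuation i (imp (PVar u) (PVar v)).
Proof. by move=> Hl; apply: holds_imp => j Hj; apply/valuationE; exact: Hl. Qed.

Lemma big_and_intro i l : (forall f, List.In f l -> holds valuation i f) ->
  holds valuation i (big_and l).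
Proof.
elim: l => //= f l IH Hl; split; first by apply: Hl; left.
by apply: IH => g gl; apply: Hl; right.
Qed.

Lemma and_all_intro i A (l : seq A) F : (forall x, holds valuation i (F x)) ->
  holds valuation i (and_all l F).
Proof. by move=> Hl; elim: l => //= x l IH; split. Qed.

Lemma reads_U i : reads (lab i) -> U i.+1.
Proof. by move=> R; apply: U_lab => E; rewrite E in R. Qed.

Lemma letter_U i b : letter (lab i) = Some b -> U i.+1.
Proof. by move=> R; apply: U_lab => E; rewrite E in R. Qed.

Lemma matched_U k a i : matched k a i -> U k /\ U i.+1.
Proof.
move=> M; have U1 : U i.+1 by case: M => /reads_U.
by split=> //; apply: U_down U1; move: (matched_lt M); lia.
Qed.

Lemma U_ltn i : U i.+1 -> U i. Proof. exact: U_down. Qed.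

(** First in, first out: the two ends of matches increase together. *)
Lemma PH_nested x y k a i : matched k a i -> Val PH x y ->
  ~ [/\ (p k < x)%O & (y <= p i.+1)%O] /\ ~ [/\ (p k <= x)%O & (y < p i.+1)%O].
Proof.
move=> M [a' [k' [i' [M' -> ->]]]].
have [Uk Ui] := matched_U M; have [Uk' Ui'] := matched_U M'.
rewrite !leNgt !p_lt //; split=> -[c1 c2].
  case: (ltngtP i' i) => [ii|ii|E]; [|lia|].
    by have := matched_mono M' M ii; lia.
  by rewrite E in M'; case: (matched_inj M M') => ? _; lia.
case: (ltnP i' i) => [ii|]; last by lia.
by have := matched_mono M' M ii; lia.
Qed.

Lemma PH_inside x y z i : U i.+1 -> (p i < z)%O -> (z < p i.+1)%O ->
  Val PH x y -> x <> z /\ y <> z.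
Proof.
move=> Ui iz zi [a [k [i' [M -> ->]]]].
have [Uk Ui'] := matched_U M; have U0 := U_ltn Ui.
split=> E; rewrite -E !p_lt // in iz zi; lia.
Qed.

Lemma holds_inside i v : (forall x y, Val v x y -> exists j,
    [/\ U j.+1, x = p j & y = p j.+1]) ->
  holds valuation i (imp (PVar v) (Box RD (Box RA (PVar PNH)))) /\
  holds valuation i (imp (PVar v) (Box RD (Box RAbar (PVar PNH)))).
Proof.
move=> Hv; split; apply: holds_imp => -[x y e] /= /Hv [j [Uj -> ->]];
  move=> [x1 y1 e1] /= [xx yy] [x2 y2 e2] /= [E _]; apply/valuationE => /= HH.
  have [] := PH_inside Uj (lt_le_trans xx e1) yy HH; by rewrite E.
have [] := PH_inside Uj xx (le_lt_trans e1 yy) HH; by rewrite E.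
Qed.

(** At the hole only a state can fill, so [x] begins a read cell in state [s]. This state does not
    fill the read cell itself, which must therefore be filled by a match with letter [a] ending
    there. *)
Lemma PFill_column a s x z : (x < z)%O ->
  (forall w, (x < w)%O -> Val (PFill a s) x w) ->
  exists k i, [/\ lab i = Cell [::] s, matched k a i & x = p i].
Proof.
move=> xz Hx; have [w xw Hw] := hole xz.
case: (Hx w xw) => [[i [Ei Ex _]]|[k [i [M kx /(Hw _ _ _ M)]]]]; last first.
  by rewrite leNgt kx.
have Ui : U i.+1 by apply: U_lab; rewrite Ei.
have xi : (x < p i.+1)%O by rewrite Ex; exact: p_mono.
case: (Hx _ xi) => [[i' [Ei' Ex' ne]]|[k [i' [M kx Ey]]]].
  case: ne; have Ui' : U i'.+1 by apply: U_lab; rewrite Ei'.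
  suff -> : i = i' by [].
  by apply: p_inj; rewrite -?Ex //; exact: U_ltn.
have [_ Ui'] := matched_U M.
by have [E] := p_inj Ui Ui' Ey; exists k, i; rewrite {2}E.
Qed.

Lemma model_match i : holds valuation i match_rules.
Proof.
apply: big_and_intro => f; rewrite /=; do 6?[case=> [<-|]] => //.
- apply: imp_box => x y x2 y2 e e2 /= [a [k [j [M -> ->]]]] /= [h1 h2] H2.
  by case: (PH_nested M H2) => -[]; split=> //; exact: ltW.
- apply: imp_box => x y x2 y2 e e2 /= [a [k [j [M -> ->]]]] /= [h1 h2] H2.
  by case: (PH_nested M H2) => _ []; rewrite h1.
- apply: imp_box => x y x2 y2 e e2 /= [a [k [j [M -> ->]]]] /= [h1 h2] H2.
  by case: (PH_nested M H2) => -[]; rewrite h2.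
- by apply: holds_bot => x y /= H1; apply.
- by apply: imp_var => x y /= [j [Ej -> ->]]; exists j; rewrite Ej.
- apply: imp_dia => x y e /= [j [Ej Ex Ey]].
  have E : lab j.+1 = next (lab j) by apply: (@lab_next _ 0); rewrite Ej.
  rewrite Ej /= in E.
  have Uj : U j.+2 by apply: U_lab; rewrite E.
  have lj := p_mono Uj (ltnSn j.+1).
  exists (p j.+1), (p j.+2), (ltW lj); split=> //.
  by exists j.+1; rewrite E.
Qed.

Lemma model_letter i b : holds valuation i (letter_rules b).
Proof.
have HL x y : Val (PLet b) x y -> exists j, [/\ U j.+1, x = p j & y = p j.+1].
  by case=> j [/letter_U Uj -> ->]; exists j.
have [in1 in2] := holds_inside i HL.
have ne j z : letter (lab j) = Some b -> ~ Val PH z (p j.+1).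
  move=> Ej [a [k [j' [M _ /(p_inj (letter_U Ej)) E]]]].
  have [_ /E [jj]] := matched_U M.
  by case: M => /reads_letter; rewrite -jj Ej.
apply: big_and_intro => f; rewrite /=; do 6?[case=> [<-|]] => //.
- apply: imp_dia => x y e /= [j [Ej Ex Ey]].
  have [|j' jj M] := @matched_ex j.+1 (j, b).
    by rewrite (gen_letter Ej) mem_rcons mem_head.
  have [_ Uj'] := matched_U M.
  have e2 : (p j < p j'.+1)%O by apply: p_mono => //; lia.
  exists (p j), (p j'.+1), (ltW e2); split; last by exists j, j'.
  by rewrite /= Ex Ey; split=> //; apply: p_mono.
- by apply: imp_var => x y [j [Ej _ ->]]; exact: ne.
- apply: imp_box => x y x2 y2 e e2 /= [j [Ej _ ->]] /= [_ <-]; exact: ne.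
- by apply: imp_var => x y [k [j [M -> ->]]]; exists b, k, j.
Qed.

Lemma model_read i s : holds valuation i (read_rules s).
Proof.
have HL x y : Val (PCell [::] s) x y -> exists j, [/\ U j.+1, x = p j & y = p j.+1].
  by case=> j [Ej -> ->]; exists j; split=> //; apply: U_lab; rewrite Ej.
have [in1 in2] := holds_inside i HL.
have nr j z : lab j = Cell [::] s -> z <> p j.+1 -> ~ Val PNR (p j) z -> False.
  move=> Ej zj []; case=> a [s' [k [j' [Ej' _ Ex Ey]]]]; case: zj; rewrite Ey.
  congr (p _.+1); apply/esym.
  by apply: p_inj Ex; apply: U_ltn; apply: U_lab; rewrite ?Ej ?Ej'.
apply: big_and_intro => f; rewrite /=; do 6?[case=> [<-|]] => //.
- apply: imp_dia => x y e /= [j [Ej Ex Ey]].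
  have Uj : U j.+1 by apply: U_lab; rewrite Ej.
  case Eq : (gen j).2 (nonempty Ej) => [|[k a] q] // _.
  have M : matched k a j by rewrite /matched Ej Eq.
  have lt2 := p_mono Uj (ltnW (matched_lt M : k < j)).
  exists (p k), (p j.+1), (ltW lt2); split; last by exists a, k, j.
  by rewrite /= Ex Ey; split=> //; apply: p_mono (matched_lt M); exact: U_ltn.
- apply: imp_box => x y x2 y2 e e2 /= [j [Ej -> _]] /= [<- _] [a [k [j' [M E _]]]].
  have Uj : U j.+1 by apply: U_lab; rewrite Ej.
  have [Uk _] := matched_U M.
  by have := matched_letter M; rewrite -(p_inj (U_ltn Uj) Uk E) Ej.
- apply: imp_box => x y x2 y2 e e2 /= [j [Ej -> ->]] /= [<- h].
  by apply: contrapT; apply: nr => // E; rewrite E ltxx in h.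
- apply: imp_box => x y x2 y2 e e2 /= [j [Ej -> ->]] /= [<- h].
  by apply: contrapT; apply: nr => // E; rewrite E ltxx in h.
Qed.

Lemma model_push i v s : holds valuation i (push_rules v s).
Proof.
case: v => [|b v] //; apply: big_and_intro => f /=; do 2?[case=> [<-|]] => //.
- by apply: imp_var => x y /= [j [Ej -> ->]]; exists j; rewrite Ej.
- apply: imp_dia => x y e /= [j [Ej Ex Ey]].
  have E : lab j.+1 = next (lab j) by apply: (@lab_next _ b); rewrite Ej.
  rewrite Ej /= in E.
  have Uj : U j.+2 by apply: U_lab; rewrite E.
  have lj := p_mono Uj (ltnSn j.+1).
  exists (p j.+1), (p j.+2), (ltW lj); split=> //.
  by exists j.+1; rewrite E.
Qed.

Lemma model_step i a s : holds valuation i (step_rules strict a s).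
Proof.
apply: big_and_intro => f; rewrite /=; do 6?[case=> [<-|]] => //.
- apply: imp_box => x y x2 y2 e e2 /= [j [Ej -> ->]] /= [<- h].
  by left; exists j; split=> // E; rewrite E ltxx in h.
- apply: imp_box => x y x2 y2 e e2 /= [j [Ej -> ->]] /= [<- h].
  by left; exists j; split=> // E; rewrite E ltxx in h.
- apply: imp_box => x y x2 y2 e e2 /= [k [j [M -> ->]]] /= [h <-].
  by right; exists k, j.
(* The antecedent places a matched read cell at [y]; the left end of its match provides the interval
   needed for [RAbar]. *)
- move=> [x y e] Hj [x2 y2 e2] /= [E lt2]; have Hy := List.Forall_inv Hj.
  rewrite /= -{}E in e2 lt2 *.
  have [k [j [Ej M Ex]]] : exists k j,
      [/\ lab j = Cell [::] s, matched k a j & y = p j].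
    apply: (PFill_column lt2) => w yw.
    have H1 : lit_holds valuation (Ival (ltW yw)) (PVar (PFill a s)).
      exact: Hy (Ival (ltW yw)) (conj erefl yw).
    by move/valuationE: H1.
  have [Uk Uj] := matched_U M; have kj := matched_lt M.
  have l1 := p_mono (U_ltn Uj) kj; have l2 := p_mono Uj (ltnSn j).
  exists (Ival (ltW l1)); rewrite /= Ex; split=> //.
  exists (Ival (ltW l2)); split=> //.
  by apply/valuationE; exists k, j.
- apply: holds_bot => x y /= [k [j [Ej M -> ->]]]; apply.
  by exists a, s, k, j.
- case Ed : (delta s a) => [[v s']|]; last first.
    case: (strict) strict_run => // /(_ isT) st.
    apply: holds_imp => j [k [j' [Ej' [_ Eq] _ _]]] /=.
    move: Ej' Eq st; rewrite /lab => Ej' Eq /(_ j' s k a (behead (gen j').2)).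
    by apply=> //; case: (gen j') Ej' Eq => c [|e q] //= -> [->].
  apply: imp_dia => x y e /= [k [j [Ej [_ Eq] Ex Ey]]].
  have E : lab j.+1 = Cell v s'.
    move: Ej Eq; rewrite /lab /=; case: (gen j) => c [|[k' a'] q] //= -> [_ ->].
    by rewrite Ed.
  have Uj : U j.+2 by apply: U_lab; rewrite E.
  have lj := p_mono Uj (ltnSn j.+1).
  exists (p j.+1), (p j.+2), (ltW lj); split=> //.
  by exists j.+1.
Qed.

Lemma model_input i k : holds valuation i (input_rules k).
Proof.
elim: k => [|k IH] //; split=> //; split.
  by apply: imp_var => x y /= [j [Ej -> ->]]; exists j; rewrite Ej.
apply: imp_dia => x y e /= [j [Ej Ex Ey]].
have E : lab j.+1 = next (lab j) by apply: (@lab_next _ 1); rewrite Ej.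
  rewrite Ej /= in E.
have Uj : U j.+2 by apply: U_lab; rewrite E.
have lj := p_mono Uj (ltnSn j.+1).
exists (p j.+1), (p j.+2), (ltW lj); split=> //.
by exists j.+1; rewrite E.
Qed.

Lemma model_holds N L : exists i, holds valuation i (And (base strict N L) (init n)).
Proof.
have U1 : U 1 by apply: U_lab.
have l01 := p_mono U1 (ltnSn 0); exists (Ival (ltW l01)).
split; last by split; [apply/valuationE; exists 0|exact: model_input].
apply: big_and_intro => f; rewrite /=; do 7?[case=> [<-|]] => //.
- by exists (Ival (lexx (p 0))).
- move=> [x y e] /= [x0 _]; apply/valuationE => -[a [k [j [M /= E _]]]].
  have [Uk _] := matched_U M.
  by rewrite E p_lt // in x0; exact: U_ltn.
- exact: model_match.
- by apply: and_all_intro => b; exact: model_letter.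
- by apply: and_all_intro => s; exact: model_read.
- by apply: and_all_intro => v; apply: and_all_intro => s; exact: model_push.
- by apply: and_all_intro => a; apply: and_all_intro => s; exact: model_step.
Qed.

End Model.

Lemma run_gen t c w : run t (start n) = Some (c, w) ->
  lab t = c /\ [seq e.2 | e <- (gen t).2] = w.
Proof.
rewrite /lab; elim: t c w => [|t IH] c w; first by case=> <- <-.
rewrite runS; case E : (run t _) => [[c0 w0]|] //=.
have [/= <- <-] := IH _ _ E; case: (gen t) => c1 q /=.
case: (letter c1) => [b [<- <-]|]; first by rewrite map_rcons.
case: c1 => [|[|//] s||] //; case: q => [|[k a] q] //=.
by case: (delta s a) => [[v s'] [<- <-]|].
Qed.

Lemma run_prefix t t' g : run t' (start n) = Some g -> t <= t' ->
  exists c w, run t (start n) = Some (c, w).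
Proof.
move=> Hr /subnKC E; move: Hr; rewrite -E run_add.
by case: (run t _) => [[c w]|] //; exists c, w.
Qed.

Lemma run_nonempty t c w s : run t.+1 (start n) = Some (c, w) ->
  lab t = Cell [::] s -> exists k a q, gen t = (Cell [::] s, (k, a) :: q) /\
  delta s a <> None.
Proof.
move=> Hr; have [c0 [w0 E]] := run_prefix Hr (leqnSn t).
have [El Eq] := run_gen E; move: Hr; rewrite runS {}E /= -El -Eq /lab.
case: (gen t) => c1 q /= {El Eq} Hr E1; move: Hr; rewrite E1 /=.
case: q => [|[k a] q] //= Hd; exists k, a, q; split=> // E.
by rewrite E in Hd.
Qed.

(** Holes are ends of letter cells, where no match ends. Letter cells recur forever, since a machine
    that only reads exhausts its queue and gets stuck. *)
Lemma diverges_sat d (T : orderType d) (p : nat -> T) N L :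
  (forall i, (p i < p i.+1)%O) -> diverges n ->
  exists V i, @holds d T V i (And (base true N L) (init n)).
Proof.
move=> p_step Hdiv.
have p_mono i j : (i < j) -> (p i < p j)%O.
  exact: (homo_ltn (@lt_trans _ T) p_step).
have runs t : exists c w, run t (start n) = Some (c, w).
  by case E : (run t (start n)) => [[c w]|]; [exists c, w | case: (Hdiv t)].
have reading i s (Ei : lab i = Cell [::] s) := let: ex_intro c (ex_intro w Hr) :=
  runs i.+1 in run_nonempty Hr Ei.
have not_flushed i : letter (lab i) = None -> reads (lab i) /\ (gen i).2 <> [::].
  have [c [w Hr]] := runs i.+1; have [c0 [w0 H0]] := runs i.
  have [El Eq] := run_gen H0; move: Hr; rewrite runS H0 /= -El -Eq.
  move=> Hr Hl; move: Hr; rewrite Hl; case: (lab i) Hl => [|[|//] s||] //= _.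
  by case: (gen i).2.
have letter_above i : exists2 k, i <= k & exists b, letter (lab k) = Some b.
  move Em : (size (gen i).2) => m; elim: m i Em => [|m IH] i Em.
    case Eb : (letter (lab i)) => [b|]; first by exists i => //; exists b.
    by case: (not_flushed i Eb) => _ []; case: (gen i).2 Em.
  case Eb : (letter (lab i)) => [b|]; first by exists i => //; exists b.
  have [R _] := not_flushed i Eb.
  have [|k ik Hk] := IH i.+1; last by exists k => //; exact: ltnW.
  by rewrite gen_read // size_behead Em.
suff [i Hi] : exists i, holds (valuation p) i (And (base true N L) (init n)).
  by exists (valuation p), i.
apply: (@model_holds d T true (fun=> True)) => //.
- by move=> i j _; exact: p_mono.
(* If no point of the sequence lies above [y], then no match ends at [z], which serves as the
   hole. *)
- move=> y z yz; have [[k yk]|no] := pselect (exists k, (y < p k)%O).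
    have [k' kk [b Eb]] := letter_above k.
    exists (p k'.+1).
      apply: lt_le_trans yk _; apply: ltW; apply: p_mono; exact: kk.
    move=> k1 a i M /eqP; case: (ltngtP i k') => [ik|ki|E _].
    - by rewrite gt_eqF // p_mono.
    - by rewrite lt_eqF // p_mono.
    - by case: M => /reads_letter; rewrite E Eb.
  exists z => // k a i M E; case: no; exists i.+1; by rewrite -E.
- by move=> i s /reading [k [a [q [-> _]]]].
- move=> _ i s k a q E; have [] := reading i s; first by rewrite /lab E.
  by move=> k' [a' [q' []]]; rewrite E => -[_ <- _].
Qed.

Definition flushing (c : cell) : bool :=
  match c with Junk | Blank => true | _ => false end.

Lemma flushing_next i j : flushing (lab i) -> i <= j -> flushing (lab j).
Proof.
move=> Hi; elim: j => [|j IH]; first by rewrite leqn0 => /eqP <-.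
rewrite leq_eqVlt => /orP[/eqP <-//|/IH]; rewrite /lab /=.
by case: (gen j) => [[|[|? ?] ?||]] [].
Qed.

Lemma flushing_blank i : flushing (lab i) -> exists2 m, i <= m & lab m = Blank.
Proof.
move Em : (size (gen i).2) => m; elim: m i Em => [|m IH] i Em Hi.
  exists i.+1; rewrite ?leqnSn //; move: Em Hi; rewrite /lab /=.
  by case: (gen i) => [[|[|? ?] ?||]] [].
have Hi' := flushing_next Hi (leqnSn i).
case E : (lab i) Hi => // _; last by exists i.
have [|//|j ij Hj] := IH i.+1; last by exists j => //; exact: ltnW.
by rewrite gen_read ?E // size_behead Em.
Qed.

Lemma blank_next i j : lab i = Blank -> i <= j -> lab j = Blank.
Proof.
move=> Hi; elim: j => [|j IH]; first by rewrite leqn0 => /eqP <-.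
rewrite leq_eqVlt => /orP[/eqP <-//|/IH]; rewrite /lab /=.
by case: (gen j) => c q /= ->.
Qed.

Lemma halts_sat N L : halts n -> exists m (V : nat -> set (ival 'I_m)) i,
  holds V i (And (base false N L) (init n)).
Proof.
case=> t [g [Ht [s [a [w [Eg Ed]]]]]]; rewrite {}Eg in Ht.
have [Et Eq] := run_gen Ht.
have Hfl : flushing (lab t.+1).
  move: Et Eq; rewrite /lab /=; case: (gen t) => c [|[k b] q] //= -> [-> _].
  by rewrite Ed.
have [m tm Hm] := flushing_blank Hfl.
have live i : lab i <> Blank -> i < m.
  by move=> Hi; rewrite ltnNge; apply/negP => /(blank_next Hm).
(* Cells that are not blank have indices below [m], so matches end at points up to [m]. The
   additional last point [m.+1] is a hole for every [y]. *)
exists m.+2; pose p i : 'I_m.+2 := inord i.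
have pE i : i <= m.+1 -> p i = i :> nat by move=> im; rewrite inordK.
suff [i Hi] : exists i, holds (valuation p) i (And (base false N L) (init n)).
  by exists (valuation p), i.
apply: (@model_holds _ 'I_m.+2 false (fun i => i <= m.+1)) => //.
- by move=> i j; exact: leq_trans.
- by move=> i /live /ltnW.
- move=> i j jm ij; rewrite ltEord /=  !pE //; exact: leq_trans (ltnW ij) jm.
- move=> y z yz; exists ord_max.
    by move: yz; rewrite !ltEord /= => yz; apply: leq_trans yz _; rewrite -ltnS.
  move=> k b i [R _] E; have im : i < m by apply: live => Hi; rewrite Hi in R.
  by have := congr1 val E; rewrite /= pE ?ltnS 1?ltnW // => Em; rewrite -Em in im; lia.
move=> i s' Ei; case: (ltngtP i t) => [it|ti|E]; last by rewrite E; case: (gen t).2 Eq.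
  have [c [w' Hr]] := run_prefix Ht it.
  by have [k [b [q [-> _]]]] := run_nonempty Hr Ei.
by have := flushing_next Hfl ti; rewrite Ei.
Qed.

End Generator.
End QueueMachine.

(** * While programs *)

Inductive cmd := Skip | Inc of nat | Seq of cmd & cmd | Loop of nat & cmd.

Definition upd (f : nat -> nat) x v : nat -> nat := fun y => if y == x then v else f y.

(* [Loop r c] is: while register r is positive, decrement it and execute c. *)
Inductive exec : cmd -> (nat -> nat) -> (nat -> nat) -> Prop :=
  | exec_skip f : exec Skip f f
  | exec_inc r f : exec (Inc r) f (upd f r (f r).+1)
  | exec_seq c1 c2 f g h : exec c1 f g -> exec c2 g h -> exec (Seq c1 c2) f h
  | exec_loop0 r c f : f r = 0 -> exec (Loop r c) f f
  | exec_loopS r c m f g h : f r = m.+1 -> exec c (upd f r m) g ->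
      exec (Loop r c) g h -> exec (Loop r c) f h.

Fixpoint code_cmd (c : cmd) : nat :=
  match c with
  | Skip => CodeSeq.code [:: 0]
  | Inc r => CodeSeq.code [:: 1; r]
  | Seq c1 c2 => CodeSeq.code [:: 2; code_cmd c1; code_cmd c2]
  | Loop r c => CodeSeq.code [:: 3; r; code_cmd c]
  end.

Lemma code_cmd_inj : injective code_cmd.
Proof.
elim=> [|r|c1 IH1 c2 IH2|r c IH] [|r'|c1' c2'|r' c'] /code_inj //; case=> //.
- by move=> ->.
- by move=> /IH1 -> /IH2 ->.
- by move=> -> /IH ->.
Qed.

(* A state is a continuation, with a flag for the phases of a loop: the queue is
   first rotated until the separator 0 comes last, then searched for a token. *)
Definition state : Type := bool * seq cmd.

Definition code_state (s : state) : nat :=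
  CodeSeq.code [:: nat_of_bool s.1; CodeSeq.code (map code_cmd s.2)].

Lemma code_state_inj : injective code_state.
Proof.
move=> [b K] [b' K'] /code_inj [Eb /code_inj /(inj_map code_cmd_inj) ->].
by case: b b' Eb => -[].
Qed.

(* Letter 0 separates; register r holds as many units as the queue holds
   letters r.+1, in any order. *)
Definition pdelta (s : state) (x : nat) : option (seq nat * state) :=
  let: (b, K) := s in
  match K with
  | [::] => None
  | Skip :: K' => Some ([:: x], (false, K'))
  | Inc r :: K' => Some ([:: x; r.+1], (false, K'))
  | Seq c1 c2 :: K' => Some ([:: x], (false, c1 :: c2 :: K'))
  | Loop r c :: K' =>
      if ~~ b then Some ([:: x], (x == 0, K))
      else if x == r.+1 then Some ([::], (false, c :: K))
      else Some ([:: x], if x == 0 then (false, K') else (true, K))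
  end.

Definition rep (w : seq nat) (f : nat -> nat) : Prop :=
  forall x, count_mem x w = if x is r.+1 then f r else 1.

(** * Simulation of while programs by queue machines *)

Section Simulation.

Variable s0 : state.

Lemma rep_perm w w' f : perm_eq w w' -> rep w f -> rep w' f.
Proof. by move=> /permP E Hf x; rewrite -E Hf. Qed.

Lemma rep_split w f : rep w f ->
  exists u v, w = u ++ 0 :: v /\ perm_eq w (v ++ u ++ [:: 0]) /\ 0 \notin v ++ u.
Proof.
move=> Hw; have w0 : 0 \in w by rewrite -has_pred1 has_count Hw.
case/splitPr: w0 Hw => u v Hw; exists u, v; split=> //; split.
  by apply/permP => a; rewrite !count_cat /= addn0 (addnC (a 0 : nat)) addnCA.
apply/count_memPn; have := Hw 0.
by rewrite !count_cat /= add1n addnS addnC => -[].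
Qed.

Local Notation R := (@reach state s0 pdelta).
Local Notation R1 := (@reach1 state s0 pdelta).
Local Notation cfg b K w := (Cell [::] ((b, K) : state), w).

Lemma reach_scan r c K w f : rep w f -> exists2 u, 0 \notin u & rep (u ++ [:: 0]) f /\
  R1 (cfg false (Loop r c :: K) w) (cfg true (Loop r c :: K) (u ++ [:: 0])).
Proof.
move=> Hw; have [u [v [E [Hp H0]]]] := rep_split Hw; rewrite {}E in Hw Hp *.
exists (v ++ u) => //; split; first by rewrite -catA; exact: rep_perm Hp Hw.
have H1 : R (cfg false (Loop r c :: K) (u ++ 0 :: v))
            (cfg false (Loop r c :: K) ((0 :: v) ++ u)).
  apply: reach_rotate => x xu /=; case: eqP => // x0.
  by move: H0; rewrite mem_cat -x0 xu orbT.
apply: reach_trans1 H1 _; exact: reach1_read.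
Qed.

(** In the second phase the separator comes to the front before any token of [r] has been met, and
    this ends the loop. *)
Lemma reach_loop0 r c K w f : rep w f -> f r = 0 -> exists2 w', rep w' f &
  R1 (cfg false (Loop r c :: K) w) (cfg false K w').
Proof.
move=> Hw fr; have [u u0 [Hu H1]] := reach_scan r c K Hw.
exists (u ++ [:: 0]) => //; apply: reach1_trans H1 _; apply: reach1W.
have H2 : R (cfg true (Loop r c :: K) (u ++ [:: 0]))
            (cfg true (Loop r c :: K) ([:: 0] ++ u)).
  apply: reach_rotate => x xu /=; case: eqP => [xr|_].
    have := Hu r.+1; rewrite count_cat /= fr !addn0 => /count_memPn.
    by rewrite -xr xu.
  by case: eqP => // x0; rewrite -x0 xu in u0.
apply: reach_trans1 H2 _; exact: reach1_read.
Qed.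

Lemma reach_search r c K u v : 0 \notin u -> r.+1 \in u ->
  exists2 w, perm_eq (u ++ v) (r.+1 :: w) &
  R1 (cfg true (Loop r c :: K) (u ++ v)) (cfg false (c :: Loop r c :: K) w).
Proof.
elim: u v => [|x u IH] v //; rewrite !inE !negb_or eq_sym => /andP[x0 u0].
case: (eqVneq r.+1 x) => [<- _|xr /= ur].
  exists (u ++ v) => //.
  have H1 : R1 (cfg true (Loop r c :: K) (r.+1 :: u ++ v))
               (cfg false (c :: Loop r c :: K) ((u ++ v) ++ [::])).
    by apply: reach1_read; rewrite /= eqxx.
  by rewrite cats0 in H1.
have [w Hw Hr] := IH (rcons v x) u0 ur; exists w.
  by apply: perm_trans Hw; rewrite -rcons_cat perm_sym perm_rcons.
have H1 : R1 (cfg true (Loop r c :: K) (x :: u ++ v))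
             (cfg true (Loop r c :: K) ((u ++ v) ++ [:: x])).
  by apply: reach1_read; rewrite /= eq_sym (negbTE xr) (negbTE x0).
by apply: reach1_trans H1 _; apply: reach1W; rewrite -catA cats1.
Qed.

Lemma reach_loopS r c K w f m : rep w f -> f r = m.+1 ->
  exists2 w', rep w' (upd f r m) &
  R1 (cfg false (Loop r c :: K) w) (cfg false (c :: Loop r c :: K) w').
Proof.
move=> Hw fr; have [u u0 [Hu H1]] := reach_scan r c K Hw.
have ur : r.+1 \in u.
  by rewrite -has_pred1 has_count; have := Hu r.+1; rewrite count_cat /= fr; lia.
have [w' Hp H2] := reach_search c K [:: 0] u0 ur.
exists w'; last by apply: reach1_trans H1 _; exact: reach1W.
move=> x; have := rep_perm Hp Hu x; rewrite /= /upd.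
case: x => [|x] //; rewrite eqSS eq_sym; case: eqP => [->|_] //=.
by rewrite fr => -[].
Qed.

Lemma reach_inc r K w f : rep w f -> exists2 w', rep w' (upd f r (f r).+1) &
  R1 (cfg false (Inc r :: K) w) (cfg false K w').
Proof.
case: w => [|x w] Hw; first by have := Hw 0.
exists (w ++ [:: x; r.+1]); last exact: reach1_read.
move=> y; have := Hw y; rewrite count_cat /= /upd.
case: y => [|y]; first by lia.
by rewrite eqSS (eq_sym r); case: (eqVneq y r) => [->|]; lia.
Qed.

Lemma reach_exec c f g : exec c f g -> forall K w, rep w f ->
  exists2 w', rep w' g & R1 (cfg false (c :: K) w) (cfg false K w').
Proof.
elim=> {c f g} [f|r f|c1 c2 f g h _ IH1 _ IH2|r c f fr|r c m f g h fr _ IH1 _ IH2]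
  K w Hw.
- case: w Hw => [|x w] Hw; first by have := Hw 0.
  exists (w ++ [:: x]); last exact: reach1_read.
  by apply: rep_perm Hw; rewrite cats1 perm_sym perm_rcons.
- exact: reach_inc.
- case: w Hw => [|x w] Hw; first by have := Hw 0.
  have Hw' : rep (w ++ [:: x]) f.
    by apply: rep_perm Hw; rewrite cats1 perm_sym perm_rcons.
  have [w1 Hw1 H1] := IH1 (c2 :: K) _ Hw'; have [w2 Hw2 H2] := IH2 K _ Hw1.
  exists w2 => //; apply: reach1_trans (reach1W (reach1_trans H1 (reach1W H2))).
  exact: reach1_read.
- exact: reach_loop0.
- have [w0 Hw0 H0] := reach_loopS c K Hw fr.
  have [w1 Hw1 H1] := IH1 (Loop r c :: K) _ Hw0.
  have [w2 Hw2 H2] := IH2 K _ Hw1; exists w2 => //.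
  exact: reach1_trans H0 (reach1W (reach1_trans H1 (reach1W H2))).
Qed.

Lemma reach_spin r K w f m : rep w f -> f r = m.+1 -> exists2 w', rep w' f &
  R1 (cfg false (Loop r (Inc r) :: K) w) (cfg false (Loop r (Inc r) :: K) w').
Proof.
move=> Hw fr; have [w1 Hw1 H1] := reach_loopS (Inc r) K Hw fr.
have [w2 Hw2 H2] := reach_inc r (Loop r (Inc r) :: K) Hw1.
exists w2; last exact: reach1_trans H1 (reach1W H2).
move=> x; rewrite Hw2; case: x => // x; rewrite /upd /=.
by case: eqP => // ->; rewrite eqxx fr.
Qed.

Lemma run_spin r K w f m t : rep w f -> f r = m.+1 ->
  exists2 t', t <= t' &
  run s0 pdelta t' (cfg false (Loop r (Inc r) :: K) w) <> None.
Proof.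
move=> + fr; elim: t w => [|t IH] w Hw; first by exists 0.
have [w' Hw' [k Hk]] := reach_spin K Hw fr; have [t' tt' Ht'] := IH _ Hw'.
exists (k.+1 + t'); first by lia.
by rewrite run_add Hk.
Qed.

End Simulation.

(** The final loop restores register [r] in each round, so it turns the output of [c] into
    behaviour: halting for zero, divergence for a positive value. *)
Definition program (c : cmd) r : cmd := Seq c (Loop r (Inc r)).
Definition program_start c r : state := (false, [:: program c r]).

Lemma rep_input n : rep (nseq n 1 ++ [:: 0]) (upd (fun=> 0) 0 n).
Proof.
move=> x; rewrite count_cat count_nseq /= /upd; case: x => [|[|x]] //=; lia.
Qed.

Section Program.

Variables (c : cmd) (r n : nat) (f : nat -> nat).
Hypothesis exec_c : exec c (upd (fun=> 0) 0 n) f.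
Let s0 := program_start c r.

Lemma program_input : reach s0 pdelta (start _ n)
  (Cell [::] s0, nseq n 1 ++ [:: 0]).
Proof. by exists n.+1; exact: run_input. Qed.

Lemma program_halts : f r = 0 -> halts s0 pdelta n.
Proof.
move=> fr; have Hp : exec (program c r) (upd (fun=> 0) 0 n) f.
  by apply: exec_seq exec_c _; exact: exec_loop0.
have [w Hw Hr] := reach_exec s0 Hp [::] (rep_input n).
have [t Ht] := reach_trans1 program_input Hr.
exists t.+1; eexists; split; first exact: Ht.
case: w Hw {Hr Ht} => [|a w] Hw; first by have := Hw 0.
by exists (false, [::]), a, w.
Qed.

Lemma program_diverges m : f r = m.+1 -> diverges s0 pdelta n.
Proof.
move=> fr; have [w0 Hw0] : exists w, rep w (upd (fun=> 0) 0 n) /\ reach s0 pdelta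
    (start _ n) (Cell [::] (false, [:: c; Loop r (Inc r)]), w).
  have := rep_input n; have [k Hk] := program_input; move: Hk.
  case: (nseq n 1 ++ [:: 0]) => [|a w] Hk Hw; first by have := Hw 0.
  exists (w ++ [:: a]); split.
    by apply: rep_perm Hw; rewrite cats1 perm_sym perm_rcons.
  apply: reach1W; apply: reach_trans1 (ex_intro _ k Hk) _; exact: reach1_read.
case: Hw0 => Hw0 H0; have [w Hw H1] := reach_exec s0 exec_c [:: Loop r (Inc r)] Hw0.
have [k Hk] := reach_trans1 H0 H1; apply: diverges_reach => t.
have [t' tt' Ht'] := run_spin s0 [::] t Hw fr.
exists (k.+1 + t'); first by lia.
by rewrite run_add Hk.
Qed.

End Program.

(* The continuations reachable from [c :: K], except the suffixes of [K]. *)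
Fixpoint conts (c : cmd) (K : seq cmd) : seq (seq cmd) :=
  (c :: K) :: match c with
  | Seq c1 c2 => conts c1 (c2 :: K) ++ conts c2 K
  | Loop r c' => conts c' (c :: K)
  | _ => [::]
  end.

Definition states (c : cmd) : seq state :=
  let Ks := [::] :: conts c [::] in
  [seq (false, K) | K <- Ks] ++ [seq (true, K) | K <- Ks].

(** A strict bound on the new letters pushed: [Inc r] pushes [r.+1]. *)
Fixpoint bound (c : cmd) : nat :=
  match c with
  | Skip => 0
  | Inc r => r.+2
  | Seq c1 c2 => maxn (bound c1) (bound c2)
  | Loop _ c => bound c
  end.

Definition bounded N (K : seq cmd) := all (fun c => bound c <= N) K.

(** [P] stands for the continuations of the whole program. Generalizing over it lets the induction
    pass to subcommands, which need only their own continuations and the one they return to. *)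
Lemma conts_closed (P : seq cmd -> Prop) N b a v s' c K :
  (forall K', List.In K' (conts c K) -> P K') -> P K ->
  bound c <= N -> bounded N K -> forall K', List.In K' (conts c K) ->
  bounded N K' /\ (a < N -> pdelta (b, K') a = Some (v, s') ->
    [/\ P s'.2, all (gtn N) v & size v <= 2]).
Proof.
elim: c K => [|r|c1 IH1 c2 IH2|r c IH] K HP PK bc bK K'; rewrite /= in bc HP *.
- case=> // <-; rewrite /= bK; split=> // aN [<- <-]; split=> //=.
  by rewrite aN.
- case=> // <-; rewrite /= bc bK; split=> // aN [<- <-]; split=> //=.
  by rewrite aN bc.
- move: bc; rewrite geq_max => /andP[b1 b2].
  have P1 K1 : List.In K1 (conts c1 (c2 :: K)) -> P K1.
    by move=> H1; apply: HP; right; apply/In_cat; left.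
  have P2 K1 : List.In K1 (conts c2 K) -> P K1.
    by move=> H1; apply: HP; right; apply/In_cat; right.
  have h1 : List.In (c1 :: c2 :: K) (conts c1 (c2 :: K)) by case: (c1); left.
  have h2 : List.In (c2 :: K) (conts c2 K) by case: (c2); left.
  case=> [<-|].
    rewrite /= geq_max b1 b2 bK; split=> // aN [<- <-]; split=> //=; first exact: P1.
    by rewrite aN.
  move=> H0; case/In_cat: H0 => H1.
    by apply: (IH1 (c2 :: K)) => //; [exact: P2 | rewrite /= b2].
  exact: (IH2 K).
- have h1 : List.In (c :: Loop r c :: K) (conts c (Loop r c :: K)) by case: (c); left.
  case=> [<-|]; last first.
    apply: IH => //; [|by apply: HP; left|by rewrite /= bc].
    by move=> K1 H1; apply: HP; right.
  rewrite /= bc bK; split=> // aN; case: (b) => /=; last first.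
    by case=> <- <-; split=> //=; [apply: HP; left | rewrite aN].
  case: eqP => _ [<- <-]; split=> //=; first by apply: HP; right.
    by case: eqP => _ //=; apply: HP; left.
  by rewrite aN.
Qed.

(** * Compiling partial recursive functions *)

Lemma exec_eq c f g h : exec c f g -> g = h -> exec c f h.
Proof. by move=> H <-. Qed.

Ltac upd_tac := apply: funext => ?; rewrite /upd /=;
  repeat (case: eqP => ?); subst; try lia; try congruence; auto.

Definition clear a : cmd := Loop a Skip.
Definition move a b : cmd := Loop a (Inc b).
Definition copy a b t : cmd := Seq (Loop a (Seq (Inc b) (Inc t))) (move t a).

Lemma exec_clear a f : exec (clear a) f (upd f a 0).
Proof.
move Em : (f a) => m; elim: m f Em => [|m IH] f Em.
  by apply: exec_eq (exec_loop0 _ Em) _; upd_tac.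
apply: exec_loopS Em (exec_skip _) _.
by apply: exec_eq (IH _ _) _; [rewrite /upd eqxx | upd_tac].
Qed.

Lemma exec_move a b f : a != b ->
  exec (move a b) f (upd (upd f b (f b + f a)) a 0).
Proof.
move=> /eqP ab; move Em : (f a) => m; elim: m f Em => [|m IH] f Em.
  by apply: exec_eq (exec_loop0 _ Em) _; upd_tac.
apply: exec_loopS Em (exec_inc _ _) _.
apply: exec_eq (IH _ _) _; last upd_tac.
by rewrite /upd eqxx; case: eqP.
Qed.

Lemma exec_copy a b t f : a != b -> a != t -> b != t -> f t = 0 ->
  exec (copy a b t) f (upd f b (f b + f a)).
Proof.
move=> ab at_ bt ft; set g := upd (upd (upd f b (f b + f a)) t (f t + f a)) a 0.
have Hg : exec (Loop a (Seq (Inc b) (Inc t))) f g.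
  rewrite /g; move: ab at_ bt => /eqP ab /eqP at_ /eqP bt {g ft}.
  move Em : (f a) => m; elim: m f Em => [|m IH] f Em.
    by apply: exec_eq (exec_loop0 _ Em) _; upd_tac.
  apply: exec_loopS Em (exec_seq (exec_inc _ _) (exec_inc _ _)) _.
  apply: exec_eq (IH _ _) _; last upd_tac.
  by rewrite /upd eqxx; do 2?case: eqP.
apply: exec_seq Hg _; apply: exec_eq (exec_move _ _) _; first by rewrite eq_sym.
by move: ab at_ bt => /eqP ab /eqP at_ /eqP bt; rewrite /g; upd_tac.
Qed.

Definition seqs (cs : seq cmd) : cmd := foldr Seq Skip cs.

Lemma exec_seqs cs (t : nat -> nat -> nat) :
  (forall j, j < size cs -> exec (nth Skip cs j) (t j) (t j.+1)) ->
  exec (seqs cs) (t 0) (t (size cs)).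
Proof.
elim: cs t => [|c cs IH] t Ht; first exact: exec_skip.
apply: exec_seq (Ht 0 isT) _.
exact: (IH (fun j => t j.+1)) (fun j => Ht j.+1).
Qed.

(** Registers from [b] on are scratch space. [Prec] keeps there the rounds left, the accumulator,
    the index of the round and the new value; [Mu] the candidate, the value of [f] at it and a flag
    for another round. The loop of [Mu] on [b.+1] is a conditional, since its body clears that
    register. *)
Fixpoint compile n (f : murec n) (ins : seq nat) (out b : nat) : cmd :=
  match f with
  | Zero => Skip
  | Succ => Seq (copy (head 0 ins) out b) (Inc out)
  | Proj _ i => copy (nth 0 ins i) out b
  | Comp k _ f gs =>
      Seq (seqs [seq compile (gs i) ins (b + i) (b + k) | i <- enum 'I_k])
          (Seq (compile f (iota b k) out (b + k))
               (seqs [seq clear (b + i) | i <- iota 0 k]))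
  | Prec _ f g =>
      Seq (copy (head 0 ins) b b.+1)
     (Seq (compile f (behead ins) b.+1 b.+4)
     (Seq (Loop b (Seq (compile g (b.+2 :: b.+1 :: behead ins) b.+3 b.+4)
             (Seq (clear b.+1) (Seq (move b.+3 b.+1) (Inc b.+2)))))
          (Seq (move b.+1 out) (clear b.+2))))
  | Mu _ f =>
      Seq (Inc b.+2)
     (Seq (Loop b.+2 (Seq (compile f (b :: ins) b.+1 b.+3)
             (Loop b.+1 (Seq (clear b.+1) (Seq (Inc b) (Inc b.+2))))))
          (move b out))
  end.

(** All registers but [out] are restored, in particular the zeros from [b] on, so calls can be
    chained and repeated. *)
Definition compile_spec n (f : murec n) := forall v r, eval f v r ->
  forall ins out b s, map s ins = v -> all (gtn b) ins -> out < b ->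
  out \notin ins -> s out = 0 -> (forall x, b <= x -> s x = 0) ->
  exec (compile f ins out b) s (upd s out r).

Lemma compile_comp k n (f : murec k) (gs : 'I_k -> murec n) :
  compile_spec f -> (forall i, compile_spec (gs i)) -> compile_spec (Comp f gs).
Proof.
move=> IHf IHg v r [w [Hw Hf]] ins out b s Hv Hb ob oins so sb /=.
(* The registers after the first [j] arguments have been computed. *)
pose t j x := if (b <= x) && (x < b + j) then nth 0 w (x - b) else s x.
have ne : forall x, x \in ins -> x < b by move=> x xi; exact: (allP Hb).
have H1 : exec (seqs [seq compile (gs i) ins (b + i) (b + k) | i <- enum 'I_k]) s (t k).
  have -> : s = t 0 by apply: funext => x; rewrite /t addn0; case: ltngtP.
  set cs := map _ _; have <- : size cs = k by rewrite size_map size_enum_ord.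
  apply: exec_seqs => j; rewrite /cs size_map => jk.
  have jk' : j < k by rewrite -(size_enum_ord k).
  pose i := Ordinal jk'.
  rewrite (nth_map i) // (nth_ord_enum i i : nth i (enum 'I_k) j = i).
  apply: exec_eq (IHg i _ _ (Hw i) _ _ _ _ _ _ _ _ _ _) _ => /=.
  - rewrite -Hv; apply/eq_in_map => x /ne xb; rewrite /t leqNgt xb //.
  - by apply/allP => x /ne /= xb; lia.
  - by rewrite ltn_add2l.
  - by apply/negP => /ne; lia.
  - by rewrite /t ltnn andbF sb // leq_addr.
  - move=> x bx; rewrite /t; case: andP => [[_ xj]|_]; first by lia.
    by apply: sb; lia.
  - apply: funext => x; rewrite /t /upd; case: eqP => [->|xj].
      by rewrite leq_addr addnS leqnn /= addKn (tnth_nth 0).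
    by congr (if _ then _ else _); lia.
apply: exec_seq H1 _.
have H2 : exec (compile f (iota b k) out (b + k)) (t k) (upd (t k) out r).
  apply: (IHf _ _ Hf) => /=.
  - apply: (@eq_from_nth _ 0); first by rewrite size_map size_iota size_tuple.
    move=> i; rewrite size_map size_iota => ik.
    by rewrite (nth_map 0) ?size_iota // nth_iota // /t leq_addr ltn_add2l ik addKn.
  - by apply/allP => x; rewrite mem_iota => /andP[].
  - by lia.
  - by rewrite mem_iota; lia.
  - by rewrite /t leqNgt ob.
  - move=> x bx; rewrite /t; case: andP => [[_ xj]|_]; first by lia.
    by apply: sb; lia.
apply: exec_seq H2 _.
(* The registers after the first [j] arguments have been cleared. *)
pose u j x := if (b <= x) && (x < b + j) then 0 else upd (t k) out r x.
have H3 : exec (seqs [seq clear (b + i) | i <- iota 0 k]) (u 0) (u k).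
  set cs := map _ _; have <- : size cs = k by rewrite size_map size_iota.
  apply: exec_seqs => j; rewrite /cs size_map size_iota => jk.
  rewrite (nth_map 0) ?size_iota // nth_iota //.
  apply: exec_eq (exec_clear _ _) _; apply: funext => x; rewrite /u {1}/upd.
  case: eqP => [->|xj]; first by rewrite add0n leq_addr addnS leqnn.
  by congr (if _ then _ else _); lia.
have <- : u 0 = upd (t k) out r.
  by apply: funext => x; rewrite /u addn0; case: ltngtP.
apply: exec_eq H3 _; apply: funext => x; rewrite /u /upd /t.
case: ifP => [/andP[bx xk]|->] //.
by case: eqP => [E|_]; [lia | rewrite sb].
Qed.

Lemma compile_prec n (f : murec n) (g : murec n.+2) :
  compile_spec f -> compile_spec g -> compile_spec (Prec f g).
Proof.
move=> IHf IHg v r /= Hr ins out b s Hv; set u := behead_tuple v in Hr.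
move: Hr; case: ins Hv => [|a ins] Hv.
  by have := congr1 size Hv; rewrite size_tuple.
have -> : thead v = s a by rewrite /thead (tnth_nth 0) -Hv.
have {Hv} Hu : map s ins = u by rewrite /= -Hv.
set rec := (X in X (s a) r -> _); set m := s a => Hr.
move=> /andP[/= ab insb] ob; rewrite inE negb_or => /andP[ao oins] so sb.
have ne x : x \in ins -> x < b by move=> xi; exact: (allP insb).
(* The registers when [k] rounds remain, [j] are done and the accumulator holds [acc]. *)
pose st k j acc := upd (upd (upd s b k) b.+1 acc) b.+2 j.
have st_ins k j acc : map (st k j acc) ins = u.
  rewrite -Hu; apply/eq_in_map => x /ne xb.
  by rewrite /st /upd; do 3?[case: eqP => ?; first by lia].
set body := Seq (compile g _ _ _) _.
have step k j acc acc' : eval g (cons_tuple j (cons_tuple acc u)) acc' ->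
    exec body (st k j acc) (st k j.+1 acc').
  move=> Hg; apply: exec_seq.
    apply: (IHg _ _ Hg) => /=; rewrite ?st_ins.
    - by rewrite /st /upd /= !eqxx; do !case: eqP => ?; lia || congr [:: _, _ & _].
    - by apply/and3P; split; [lia|lia|apply/allP => x /ne /=; lia].
    - by [].
    - by rewrite !inE; do !case: eqP => ? /=; try lia; apply/negP => /ne; lia.
    - by rewrite /st /upd; do !case: eqP => ?; try lia; apply: sb; lia.
    - by move=> x bx; rewrite /st /upd; do !case: eqP => ?; try lia; apply: sb; lia.
  apply: exec_seq (exec_clear _ _) _; apply: exec_seq (exec_move _ _) _.
    by apply/eqP; lia.
  apply: exec_eq (exec_inc _ _) _; rewrite /st.
  have s3 : s b.+3 = 0 by apply: sb; lia.
  by upd_tac.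
(* The execution is extended backwards to round 0, because [rec] yields the earlier values from the
   later one. *)
have loop j acc : rec j acc -> exists2 r0, eval f u r0 & forall k h,
    exec (Loop b body) (st k j acc) h -> exec (Loop b body) (st (k + j) 0 r0) h.
  elim: j acc => [|j IH] acc; first by exists acc => // k h; rewrite addn0.
  move=> [acc0 [/IH [r0 Hr0 H0] Hg]]; exists r0 => // k h Hh.
  rewrite addnS -addSn; apply: H0; apply: (exec_loopS (m := k) _ _ Hh).
  - by rewrite /st /upd; do !case: eqP => ?; lia.
  - have -> : upd (st k.+1 j acc0) b k = st k j acc0 by rewrite /st; upd_tac.
    exact: step.
have [r0 Hr0 H0] := loop _ _ Hr.
apply: exec_seq (exec_copy _ _ _ _) _ => /=; [lia|lia|lia|by apply: sb; lia|].
apply: exec_seq.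
  apply: (IHf _ _ Hr0).
  - by rewrite -Hu; apply/eq_in_map => x /ne xb; rewrite /upd; case: eqP => ?; lia.
  - by apply/allP => x /ne /=; lia.
  - by lia.
  - by apply/negP => /ne; lia.
  - by rewrite /upd; case: eqP => ?; [lia|apply: sb; lia].
  - by move=> x bx; rewrite /upd; case: eqP => ?; [lia|apply: sb; lia].
have -> : upd (upd s b (s b + s a)) b.+1 r0 = st (0 + m) 0 r0.
  have s1 : s b = 0 by apply: sb; lia.
  have s2 : s b.+2 = 0 by apply: sb; lia.
  by rewrite /st /m; upd_tac.
apply: exec_seq (H0 _ _ (exec_loop0 _ _)) _.
  by rewrite /st /upd; do !case: eqP => ?; lia.
apply: exec_seq (exec_move _ _) _; first by lia.
apply: exec_eq (exec_clear _ _) _; rewrite /st.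
have s1 : s b = 0 by apply: sb; lia.
have s2 : s b.+1 = 0 by apply: sb; lia.
have s3 : s b.+2 = 0 by apply: sb; lia.
by upd_tac.
Qed.

Lemma compile_mu n (f : murec n.+1) : compile_spec f -> compile_spec (Mu f).
Proof.
move=> IHf v r /= [Hr Hm] ins out b s Hv insb ob oins so sb.
have ne x : x \in ins -> x < b by move=> xi; exact: (allP insb).
pose st j val flag := upd (upd (upd s b j) b.+1 val) b.+2 flag.
have st_ins k j acc : map (st k j acc) ins = v.
  rewrite -Hv; apply/eq_in_map => x /ne xb.
  by rewrite /st /upd; do 3?[case: eqP => ?; first by lia].
have call j val : eval f (cons_tuple j v) val ->
    exec (compile f (b :: ins) b.+1 b.+3) (st j 0 0) (st j val 0).
  move=> Hf; apply: exec_eq (IHf _ _ Hf _ _ _ _ _ _ _ _ _ _) _.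
  - by rewrite /= st_ins /st /upd; do !case: eqP => ?; lia || congr (_ :: _).
  - by rewrite /= ltnS leqW //; apply/allP => x /ne /=; lia.
  - by [].
  - by rewrite inE; case: eqP => ? /=; [lia|apply/negP => /ne; lia].
  - by rewrite /st /upd; do !case: eqP => ?; lia.
  - by move=> x bx; rewrite /st /upd; do !case: eqP => ?; try lia; apply: sb; lia.
  - by rewrite /st; upd_tac.
set body := Seq (compile f _ _ _) _.
have again j val : eval f (cons_tuple j v) val.+1 ->
    exec body (st j 0 0) (st j.+1 0 1).
  move=> /call Hc; apply: exec_seq Hc _; apply: (exec_loopS (m := val)).
  - by rewrite /st /upd; do !case: eqP => ?; try lia; reflexivity.
  - apply: exec_seq (exec_clear _ _) _.
    exact: exec_seq (exec_inc _ _) (exec_inc _ _).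
  - apply: exec_eq (exec_loop0 _ _) _; last by rewrite /st; upd_tac.
    by rewrite /st /upd; do !case: eqP => ?; lia.
(* Backwards again: an execution from candidate [j] on is preceded by the failing candidates below
   [j]. *)
have loop j h : j <= r -> exec (Loop b.+2 body) (st j 0 1) h ->
    exec (Loop b.+2 body) (st 0 0 1) h.
  elim: j => [//|j IH] jr Hh; apply: IH; first exact: ltnW.
  have [val Hval] := Hm _ jr.
  apply: (exec_loopS (m := 0) _ _ Hh); first by rewrite /st /upd eqxx.
  have -> : upd (st j 0 1) b.+2 0 = st j 0 0 by rewrite /st; upd_tac.
  exact: again Hval.
have last_iter : exec (Loop b.+2 body) (st r 0 1) (st r 0 0).
  apply: (@exec_loopS _ _ 0 _ (st r 0 0)); first by rewrite /st /upd eqxx.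
    have -> : upd (st r 0 1) b.+2 0 = st r 0 0 by rewrite /st; upd_tac.
    apply: exec_seq (call _ _ Hr) _; apply: exec_loop0.
    by rewrite /st /upd; do !case: eqP => ?; lia.
  by apply: exec_loop0; rewrite /st /upd eqxx.
have s1 : s b = 0 by apply: sb; lia.
have s2 : s b.+1 = 0 by apply: sb; lia.
have s3 : s b.+2 = 0 by apply: sb; lia.
apply: exec_seq (exec_inc _ _) _; rewrite s3.
have -> : upd s b.+2 1 = st 0 0 1 by rewrite /st; upd_tac.
apply: exec_seq (loop _ _ (leqnn r) last_iter) _.
apply: exec_eq (exec_move _ _) _; first by lia.
by rewrite /st; upd_tac.
Qed.

Lemma compileP n (f : murec n) : compile_spec f.
Proof.
elim: f => {n} [||n i|k n f IHf gs IHg|n f IHf g IHg|n f IHf].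
- move=> v r /= -> ins out b s _ _ _ _ so _.
  by apply: exec_eq (exec_skip _) _; upd_tac.
- move=> v r /= -> [|a ins] out b s Hv //.
    by have := congr1 size Hv; rewrite size_tuple.
  move=> /andP[/= ab _] ob; rewrite inE negb_or => /andP[/eqP ao _] so sb.
  apply: exec_seq (exec_copy _ _ _ _) _; try lia; first exact: sb.
  apply: exec_eq (exec_inc _ _) _.
  have -> : thead v = s a by rewrite /thead (tnth_nth 0) -Hv.
  by upd_tac.
- move=> v r /= -> ins out b s Hv insb ob oins so sb.
  have Hs : size ins = n by rewrite -(size_map s) Hv size_tuple.
  have ii : nth 0 ins i \in ins by rewrite mem_nth // Hs.
  have ib : nth 0 ins i < b by exact: (allP insb).
  have io : nth 0 ins i != out by apply: contraNneq oins => <-.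
  apply: exec_eq (exec_copy _ _ _ _) _; try lia; first exact: sb.
  by rewrite so add0n (tnth_nth 0) -Hv (nth_map 0) // Hs.
- exact: compile_comp.
- exact: compile_prec.
- exact: compile_mu.
Qed.

(** * The reduction *)

Definition computable k (F : k.-tuple nat -> nat) : Prop :=
  exists f : murec k, forall v, eval f v (F v).

Lemma eq_computable k (F G : k.-tuple nat -> nat) :
  F =1 G -> computable F -> computable G.
Proof. by move=> E [f Hf]; exists f => v; rewrite -E. Qed.

Lemma computable_comp1 k (G : 1.-tuple nat -> nat) (F : k.-tuple nat -> nat) :
  computable G -> computable F -> computable (fun v => G [tuple F v]).
Proof.
move=> [g Hg] [f Hf]; exists (Comp g (fun=> f)) => v.
by exists [tuple F v]; split=> // i; rewrite (tnth_nth 0) ord1.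
Qed.

Lemma computable_comp2 k (G : 2.-tuple nat -> nat) (F1 F2 : k.-tuple nat -> nat) :
  computable G -> computable F1 -> computable F2 ->
  computable (fun v => G [tuple F1 v; F2 v]).
Proof.
move=> [g Hg] [f1 H1] [f2 H2].
exists (Comp g (fun i : 'I_2 => if i == ord0 then f1 else f2)) => v.
exists [tuple F1 v; F2 v]; split=> // -[[|[|//]] i2]; rewrite (tnth_nth 0) /=.
  exact: H1.
exact: H2.
Qed.

Lemma computable_proj k (i : 'I_k) : computable (fun v => tnth v i).
Proof. by exists (Proj i). Qed.

Lemma computable_succ k (F : k.-tuple nat -> nat) :
  computable F -> computable (fun v => (F v).+1).
Proof.
have HS : computable (fun v : 1.-tuple nat => (thead v).+1) by exists Succ.
by move/(computable_comp1 HS).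
Qed.

Lemma computable_const k c : computable (fun _ : k.-tuple nat => c).
Proof.
elim: c => [|c]; last exact: computable_succ.
have noarg : 'I_0 -> murec k by case.
by exists (Comp Zero noarg) => v; exists [tuple]; split=> // -[].
Qed.

Lemma computable_rec k (F : k.-tuple nat -> nat) (G : k.+2.-tuple nat -> nat)
    (K : nat -> k.-tuple nat -> nat) :
  computable F -> computable G -> (forall u, K 0 u = F u) ->
  (forall m u, K m.+1 u = G (cons_tuple m (cons_tuple (K m u) u))) ->
  computable (fun v : k.+1.-tuple nat => K (thead v) (behead_tuple v)).
Proof.
move=> [f Hf] [g Hg] K0 KS; exists (Prec f g) => v /=.
elim: (thead v) => [|m IH]; first by rewrite K0; exact: Hf.
by exists (K m (behead_tuple v)); split=> //; rewrite KS.
Qed.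

Lemma computable_double k (F : k.-tuple nat -> nat) :
  computable F -> computable (fun v => (F v).*2).
Proof.
have HD : computable (fun v : 1.-tuple nat => (thead v).*2).
  apply: (@computable_rec 0 (fun=> 0) (fun v => (tnth v (inord 1)).+2)
    (fun m _ => m.*2)) => //.
  - exact: computable_const.
  - by do 2!apply: computable_succ; exact: computable_proj.
  - by move=> m u; rewrite (tnth_nth 0) /= inordK.
by move/(computable_comp1 HD).
Qed.

(* The code of the sequence with head x and tail coded by s. *)
Definition ccons (x s : nat) : nat := 2 ^ x * s.*2.+1.

Lemma computable_cons k (F G : k.-tuple nat -> nat) :
  computable F -> computable G -> computable (fun v => ccons (F v) (G v)).
Proof.
have HC : computable (fun v : 2.-tuple nat =>
    (fun m u => ccons m (thead u)) (thead v) (behead_tuple v)).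
  apply: (@computable_rec 1 (fun u => (thead u).*2.+1)
    (fun v => (tnth v (inord 1)).*2) (fun m u => ccons m (thead u))).
  - by apply: computable_succ; apply: computable_double; exact: computable_proj.
  - by apply: computable_double; exact: computable_proj.
  - by move=> u; rewrite /ccons mul1n.
  - move=> m u; rewrite (tnth_nth 0) /= inordK //= /ccons expnS -mulnA mul2n.
    by [].
by move=> HF HG; exact: (computable_comp2 HC HF HG).
Qed.

(** * Reversal of the order *)

Definition mirror_rel (R : hs_rel) : hs_rel :=
  match R with
  | RA => RAbar | RB => RE | RE => RB | RD => RD | RL => RLbar | RO => RObar
  | RAbar => RA | RBbar => REbar | REbar => RBbar | RDbar => RDbar
  | RLbar => RL | RObar => RO
  end.

Fixpoint mirror_lit (l : literal) : literal :=
  match l with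
  | Dia R l => Dia (mirror_rel R) (mirror_lit l)
  | Box R l => Box (mirror_rel R) (mirror_lit l)
  | _ => l
  end.

Fixpoint mirror (phi : hs_horn) : hs_horn :=
  match phi with
  | Lit l => Lit (mirror_lit l)
  | Clause ls l => Clause (map mirror_lit ls) (mirror_lit l)
  | And phi psi => And (mirror phi) (mirror psi)
  end.

Lemma mirror_core phi : is_core phi -> is_core (mirror phi).
Proof.
elim: phi => [l|[|l1 [|l2 [|? ?]]] l|phi IH1 psi IH2] //=.
  by case: l.
by move=> /andP[/IH1 -> /IH2 ->].
Qed.

Section Mirror.

Variables (d : Order.disp_t) (T : orderType d).

Lemma dual_le (i : ival T) : (hi i <= lo i :> T^d)%O.
Proof. by rewrite leEdual; exact: lo_le_hi. Qed.

Definition dual (i : ival T) : ival T^d := Ival (dual_le i).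

Lemma undual_le (i : ival T^d) : (hi i <= lo i :> T)%O.
Proof. by have := lo_le_hi i; rewrite leEdual. Qed.

Definition undual (i : ival T^d) : ival T := Ival (undual_le i).

Lemma dualK : cancel dual undual.
Proof. by case=> x y e; congr Ival; exact: bool_irrelevance. Qed.

Lemma undualK : cancel undual dual.
Proof. by case=> x y e; congr Ival; exact: bool_irrelevance. Qed.

Lemma rel_sem_mirror R (i j : ival T) :
  rel_sem (mirror_rel R) i j <-> rel_sem R (dual i) (dual j).
Proof.
by case: R => /=; rewrite ?ltEdual; split=> //; case=> *; split.
Qed.

Lemma lit_holds_mirror (V : nat -> set (ival T^d)) i l :
  lit_holds (fun p j => V p (dual j)) i (mirror_lit l) <-> lit_holds V (dual i) l.
Proof.
elim: l i => //= R l IH i; split.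
- by move=> [j [/rel_sem_mirror Rj /IH Hj]]; exists (dual j).
- move=> [j [Rj Hj]]; exists (undual j); rewrite -(undualK j) in Rj Hj.
  by split; [apply/rel_sem_mirror | apply/IH].
- move=> H j Rj; rewrite -(undualK j) in Rj *.
  by apply/IH; apply: H; apply/rel_sem_mirror.
- by move=> H j /rel_sem_mirror /H /IH.
Qed.

Lemma holds_mirror (V : nat -> set (ival T^d)) i phi :
  holds (fun p j => V p (dual j)) i (mirror phi) <-> holds V (dual i) phi.
Proof.
elim: phi i => [l|ls l|phi IH1 psi IH2] i /=.
- exact: lit_holds_mirror.
- have HF j : List.Forall (lit_holds (fun p j => V p (dual j)) j) (map mirror_lit ls)
      <-> List.Forall (lit_holds V (dual j)) ls.
    elim: ls => [|l1 ls IH] /=; first by split; constructor.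
    split=> H; constructor; try (apply/lit_holds_mirror || apply/IH);
      by [exact: List.Forall_inv H | exact: List.Forall_inv_tail H].
  split=> H j.
    by rewrite -(undualK j) => /HF /H /lit_holds_mirror.
  by move=> /HF /H /lit_holds_mirror.
- by rewrite IH1 IH2.
Qed.

End Mirror.

Definition orient (o : bool) phi := if o then mirror phi else phi.

Lemma states_In c b K :
  List.In (b, K) (states c) <-> List.In K ([::] :: conts c [::]).
Proof.
have pairE b' l : List.In (b, K) [seq (b', K') | K' <- l] <-> b' = b /\ List.In K l.
  elim: l => [|K1 l IH]; first by split=> // -[].
  split=> /=.
    by case=> [[-> ->]|/IH [-> ?]]; split=> //; [left | right].
  by case=> Eb [->|Hl]; [left; rewrite Eb | right; exact/IH].
rewrite /states; split.
  by move=> H; case/In_cat: H => /pairE [].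
by move=> H; apply/In_cat; case: b pairE => pairE; [right|left]; apply/pairE.
Qed.

Lemma holds_And d (T : orderType d) V (i : ival T) phi psi :
  holds V i (And phi psi) <-> holds V i phi /\ holds V i psi.
Proof. by []. Qed.

(** * The formula of a program and its satisfiability *)

Section Reduction.

Variables (c : cmd) (r : nat) (strict o : bool).

Let p := program c r.
Let N := maxn 2 (bound p).

Definition formula_base := orient o
  (base (program_start c r) pdelta code_state strict N (states p)).
Definition formula_input n := orient o (@init state code_state n).
Definition formula n := And formula_base (formula_input n).

Lemma formula_core n : is_core (formula n).
Proof.
have orient_core phi : is_core phi -> is_core (orient o phi).
  by rewrite /orient; case: o => //; exact: mirror_core.
by apply/andP; split; apply: orient_core; [exact: base_core | exact: init_core].
Qed.

Lemma program_closed s a v s' : List.In s (states p) -> a < N ->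
  pdelta s a = Some (v, s') ->
  [/\ List.In s' (states p), all (gtn N) v & size v <= 2].
Proof.
case: s => b K /states_In KL aN; case: s' => b' K'.
case: KL => [<- //|KL] E.
pose P K := List.In K ([::] :: conts p [::]).
have HP K1 : List.In K1 (conts p [::]) -> P K1 by right.
have [] := conts_closed b a v (b', K') HP (or_introl erefl) (leq_maxr 2 _)
  (isT : bounded N [::]) KL.
by move=> _ /(_ aN E) [P' aN' sv]; split=> //; exact/states_In.
Qed.

Lemma program_start_In : List.In (program_start c r) (states p).
Proof. by apply/states_In; right; left. Qed.

Let N2 : 1 < N. Proof. by rewrite leq_max. Qed.

Lemma unsat_halts n : strict -> halts (program_start c r) pdelta n ->
  forall d (T : orderType d) V i, ~ @holds d T V i (formula n).
Proof.
move=> st Hh d T V i; rewrite /formula /formula_base /formula_input /orient.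
case: o; last first.
  move=> /holds_And [H1 H2].
  exact: (strict_not_halts H1 H2 N2 program_start_In program_closed st Hh).
pose W q j := V q (undual j).
have -> : V = (fun q j => W q (dual j)) by do 2!apply: funext => ?; rewrite /W dualK.
move=> /holds_And [/holds_mirror H1 /holds_mirror H2].
exact: (strict_not_halts H1 H2 N2 program_start_In program_closed st Hh).
Qed.

Lemma unsat_diverges n d (T : orderType d) V i : o = false -> Fin T ->
  diverges (program_start c r) pdelta n -> ~ @holds d T V i (formula n).
Proof.
rewrite /formula /formula_base /formula_input /orient => -> FT Hd /holds_And [H1 H2].
exact: (finite_not_diverges H1 H2 N2 program_start_In program_closed FT Hd).
Qed.

Lemma sat_diverges n d (T : orderType d) (q : nat -> T) : strict ->
  (forall i, if o then (q i.+1 < q i)%O else (q i < q i.+1)%O) ->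
  diverges (program_start c r) pdelta n ->
  exists V i, @holds d T V i (formula n).
Proof.
rewrite /formula /formula_base /formula_input /orient => -> Hq Hd.
case: o Hq => Hq; last by apply: diverges_sat Hd => //; exact: code_state_inj.
have Hq' i : ((q i : T^d) < q i.+1)%O by rewrite ltEdual.
have [V [i /holds_And [H1 H2]]] := diverges_sat code_state_inj N (states p) Hq' Hd.
exists (fun s j => V s (dual j)), (undual i).
by apply/holds_And; split; apply/holds_mirror; rewrite undualK.
Qed.

Lemma sat_halts n : o = false -> strict = false ->
  halts (program_start c r) pdelta n ->
  exists m (V : nat -> set (ival 'I_m)) i, holds V i (formula n).
Proof.
rewrite /formula /formula_base /formula_input /orient => -> -> Hd.
by apply: halts_sat Hd; exact: code_state_inj.
Qed.

End Reduction.

(** * Computability of the codes and diagonalization *)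

Lemma code_cons x s : CodeSeq.code (x :: s) = ccons x (CodeSeq.code s).
Proof. by []. Qed.

Lemma code_nil : CodeSeq.code [::] = 0.
Proof. by []. Qed.

Lemma code_horn_And phi psi :
  code_horn (And phi psi) = CodeSeq.code [:: 2; code_horn phi; code_horn psi].
Proof. by []. Qed.

Lemma code_horn_imp l m : code_horn (imp l m) =
  CodeSeq.code [:: 1; CodeSeq.code [:: code_lit l]; code_lit m].
Proof. by []. Qed.

Lemma code_horn_Lit l : code_horn (Lit l) = CodeSeq.code [:: 0; code_lit l].
Proof. by []. Qed.

Lemma code_Var x : code_lit (Var x) = CodeSeq.code [:: 2; x].
Proof. by []. Qed.

Lemma code_Dia R l : code_lit (Dia R l) = CodeSeq.code [:: 3; code_rel R; code_lit l].
Proof. by []. Qed.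

Lemma orient_input o k : orient o (input_rules code_state k.+1) =
  And (And (imp (Var k.+1.*2.+1) (PVar code_state (PLet _ 1)))
           (imp (Var k.+1.*2.+1) (Dia (if o then RAbar else RA) (Var k.*2.+1))))
      (orient o (input_rules code_state k)).
Proof. by case: o. Qed.

Lemma formula_inputE o n : formula_input o n =
  And (Lit (Var n.*2.+1)) (orient o (input_rules code_state n)).
Proof. by case: o. Qed.

(** The input rules arise by primitive recursion on the number of input cells, whose variables have
    explicit indices. *)
Lemma code_input_computable o :
  computable (fun v : 1.-tuple nat => code_horn (formula_input o (thead v))).
Proof.
have constP := computable_const.
have varP k (F : k.-tuple nat -> nat) : computable F ->
    computable (fun v => code_lit (Var (F v).*2.+1)).
  move=> HF; apply: (@eq_computable _ (fun v => ccons 2 (ccons (F v).*2.+1 0))).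
    by move=> v; rewrite code_Var !code_cons code_nil.
  apply: computable_cons => //; apply: computable_cons => //.
  by apply: computable_succ; exact: computable_double.
pose lit1 := code_lit (PVar code_state (PLet _ 1)).
pose R := code_rel (if o then RAbar else RA).
pose var k := code_lit (Var k.*2.+1).
pose rule x y := ccons 1 (ccons (ccons x 0) (ccons y 0)).
pose dia x := ccons 3 (ccons R (ccons x 0)).
pose K k := code_horn (orient o (input_rules code_state k)).
have KS k : K k.+1 = ccons 2 (ccons (ccons 2 (ccons (rule (var k.+1) lit1)
    (ccons (rule (var k.+1) (dia (var k))) 0))) (ccons (K k) 0)).
  rewrite /K orient_input !code_horn_And !code_horn_imp code_Dia.
  by rewrite !code_cons code_nil.
have HK : computable (fun v : 1.-tuple nat => K (thead v)).
  have HP (i : 'I_2) : computable (fun v : 2.-tuple nat => tnth v i).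
    exact: computable_proj.
  apply: (@computable_rec 0 (fun=> K 0) (fun v => let k := tnth v (inord 0) in
    ccons 2 (ccons (ccons 2 (ccons (rule (var k.+1) lit1)
    (ccons (rule (var k.+1) (dia (var k))) 0))) (ccons (tnth v (inord 1)) 0)))
    (fun k _ => K k)) => //.
    have HS : computable (fun v : 2.-tuple nat => (tnth v (inord 0)).+1).
      by apply: computable_succ; exact: HP.
    have V1 := varP _ _ HS; have V0 := varP _ _ (HP (inord 0)).
    have ruleP (F G : 2.-tuple nat -> nat) : computable F -> computable G ->
        computable (fun v => rule (F v) (G v)).
      by move=> HF HG; do ![apply: computable_cons => //].
    apply: computable_cons => //; apply: computable_cons; last first.
      by apply: computable_cons => //; exact: HP.
    apply: computable_cons => //; apply: computable_cons; first exact: ruleP.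
    apply: computable_cons => //; apply: ruleP => //.
    by do ![apply: computable_cons => //].
  by move=> m u; rewrite KS !(tnth_nth 0) /= !inordK.
have HT : computable (fun v : 1.-tuple nat => thead v) by exact: computable_proj.
apply: (@eq_computable _ (fun v => ccons 2 (ccons (ccons 0 (ccons (var (thead v)) 0))
  (ccons (K (thead v)) 0)))).
  move=> v; rewrite formula_inputE code_horn_And code_horn_Lit !code_cons.
  by rewrite code_nil.
apply: computable_cons => //; apply: computable_cons; last first.
  exact: computable_cons.
by do 2![apply: computable_cons => //]; exact: varP.
Qed.

(* With [strict], the formula is satisfiable iff the program diverges, and
   otherwise iff it halts; the program run on the code of its own base formula
   does the opposite of what f predicts. *)
Lemma undecidable_satisfiable d (C : orderType d -> Prop) (strict o : bool) :
  (forall c r n, 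
     (if strict then diverges (program_start c r) pdelta n
      else halts (program_start c r) pdelta n) ->
     satisfiable C (formula c r strict o n)) ->
  (forall c r n, 
     (if strict then halts (program_start c r) pdelta n
      else diverges (program_start c r) pdelta n) ->
     ~ satisfiable C (formula c r strict o n)) ->
  undecidable code_horn is_core (satisfiable C).
Proof.
move=> Hsat Hunsat [f Hf].
(* From [n] this computes the code of the conjunction of the formula coded by [n] and the input
   formula for [n]. *)
have [g Hg] : computable (fun v : 1.-tuple nat =>
    ccons 2 (ccons (thead v) (ccons (code_horn (formula_input o (thead v))) 0))).
  have HP : computable (fun v : 1.-tuple nat => thead v) by exact: computable_proj.
  do ![exact: computable_const | exact: HP | exact: code_input_computable
      | apply: computable_cons].
(* Output zero means halting. A strict formula is satisfiable in case of divergence, so the answer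
   must be negated; otherwise it is kept. *)
have [h Hh] : computable (fun v : 1.-tuple nat =>
    (fun m _ => if strict then nat_of_bool (m == 0) else m) (thead v) (behead_tuple v)).
  apply: (@computable_rec 0 (fun=> nat_of_bool strict)
    (fun v => if strict then 0 else (tnth v (inord 0)).+1)
    (fun m _ => if strict then nat_of_bool (m == 0) else m)).
  - exact: computable_const.
  - case: strict {Hsat Hunsat}; first exact: computable_const.
    by apply: computable_succ; exact: computable_proj.
  - by move=> u; case: strict {Hsat Hunsat}.
  - by move=> m u; rewrite (tnth_nth 0) /= inordK //; case: strict {Hsat Hunsat}.
(* Input in register 0, output in register 1, scratch from 2. The program does not contain its own
   code: it receives [e] as input and thereby consults [f] about [formula c 1 strict o e]. *)
pose c := compile (Comp h (fun=> Comp f (fun=> g))) [:: 0] 1 2.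
pose e := code_horn (formula_base c 1 strict o).
have Hc b : eval f [tuple code_horn (formula c 1 strict o e)] b ->
    exec c (upd (fun=> 0) 0 e) (upd (upd (fun=> 0) 0 e) 1
      (if strict then nat_of_bool (b == 0) else b)).
  move=> Hb; apply: (compileP (v := [tuple e])) => //=; last first.
    by case.
  exists [tuple b]; split; last exact: Hh.
  move=> i; rewrite (tnth_nth 0) ord1 /=.
  exists [tuple code_horn (formula c 1 strict o e)]; split=> // j.
  by rewrite (tnth_nth 0) ord1 /=; have := Hg [tuple e].
pose halt := halts (program_start c 1) pdelta e.
pose div := diverges (program_start c 1) pdelta e.
have Hrun b : eval f [tuple code_horn (formula c 1 strict o e)] b ->
    if strict (+) (b == 0) then halt else div.
  move=> /Hc; move Eg: (upd _ 1 _) => g' Hs.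
  have : g' 1 = if strict then nat_of_bool (b == 0) else b.
    by rewrite -Eg /upd eqxx.
  case: (strict); case: b {Eg} => [|b] /= Es.
  - exact (@program_diverges c 1 e g' Hs 0 Es).
  - exact: program_halts Hs Es.
  - exact: program_halts Hs Es.
  - exact (@program_diverges c 1 e g' Hs b Es).
have [H1 H0] := Hf _ (formula_core c 1 strict o e).
case: (pselect (satisfiable C (formula c 1 strict o e))) => Hs.
  case: (Hunsat _ _ _ _ Hs); have := Hrun _ (H1 Hs).
  by rewrite /halt /div; case: (strict).
apply: (Hs); apply: Hsat; have := Hrun _ (H0 Hs).
by rewrite /halt /div; case: (strict).
Qed.

(** Without such chains every nonempty set has a least and a greatest element. The greatest [a] with
    finitely many points below it must be the last point, since the next point [c] would also have
    only finitely many; so the order is finite. *)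
Lemma infinite_chain d (T : orderType d) : infinite_set [set: T]%classic ->
  (exists q : nat -> T, forall i, (q i < q i.+1)%O) \/
  (exists q : nat -> T, forall i, (q i.+1 < q i)%O).
Proof.
move=> Tinf.
have chain (R : T -> T -> Prop) (A : set T) x0 : A x0 ->
    (forall x, A x -> exists2 y, A y & R x y) ->
    exists q : nat -> T, forall i, R (q i) (q i.+1).
  move=> Ax0 HA; have HA' (x : T) : exists y, A x -> A y /\ R x y.
    by have [/HA [y]|] := pselect (A x); [exists y | exists x].
  have [g Hg] := choice HA'.
  have Ag i : A (iter i g x0) by elim: i => //= i /Hg [].
  by exists (fun i => iter i g x0) => i; case: (Hg _ (Ag i)).
have [[A [x0 Ax0 HA]]|nomax] := pselect (exists A : set T, exists2 x0, A x0 &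
    forall x, A x -> exists2 y, A y & (x < y)%O).
  by left; exact: (chain (fun x y => (x < y)%O)) Ax0 HA.
have [[A [x0 Ax0 HA]]|nomin] := pselect (exists A : set T, exists2 x0, A x0 &
    forall x, A x -> exists2 y, A y & (y < x)%O).
  by right; exact: (chain (fun x y => (y < x)%O)) Ax0 HA.
exfalso.
have min (A : set T) x0 : A x0 -> exists2 x, A x & forall y, A y -> (x <= y)%O.
  move=> Ax0; apply: contrapT => H; apply: nomin; exists A, x0 => // x Ax.
  apply: contrapT => H'; apply: H; exists x => // y Ay.
  by rewrite leNgt; apply/negP => yx; apply: H'; exists y.
have max (A : set T) x0 : A x0 -> exists2 x, A x & forall y, A y -> (y <= x)%O.
  move=> Ax0; apply: contrapT => H; apply: nomax; exists A, x0 => // x Ax.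
  apply: contrapT => H'; apply: H; exists x => // y Ay.
  by rewrite leNgt; apply/negP => yx; apply: H'; exists y.
have [x0 _] : exists x0 : T, True.
  by apply: contrapT => H; apply: Tinf; have -> : [set: T]%classic = set0;
    [apply/seteqP; split => // x _; apply: H; exists x | exact: finite_set0].
pose below x := [set y : T | (y <= x)%O]%classic.
have [b _ Hb] := min [set: T]%classic x0 I.
have Ab : finite_set (below b).
  have -> : below b = [set b]%classic; last exact: finite_set1.
  apply/seteqP; split => y /=; last by move=> ->; exact: lexx.
  by move=> yb; apply/eqP; rewrite eq_le yb Hb.
have [a Aa Ha] := max (fun x => finite_set (below x)) b Ab.
have [[z az]|noz] := pselect (exists z, (a < z)%O); last first.
  apply: Tinf; have -> // : [set: T]%classic = below a.
  apply/seteqP; split => // y _; rewrite /below /= leNgt.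
  by apply/negP => ay; apply: noz; exists y.
have [c ac Hc] := min (fun y => (a < y)%O) z az.
suff : (c <= a)%O by rewrite leNgt ac.
apply: Ha; have -> : below c = (below a `|` [set c])%classic.
  apply/seteqP; split => y; rewrite /below /=.
    rewrite le_eqVlt => /orP[/eqP ->|yc]; [by right | left].
    by rewrite leNgt; apply/negP => /Hc; rewrite leNgt yc.
  by case=> [ya|->]; [exact: le_trans ya (ltW ac) | exact: lexx].
by rewrite finite_setU; split=> //; exact: finite_set1.
Qed.

Theorem theorem4p4 (d : Order.disp_t) :
  (forall C : orderType d -> Prop,
     (exists T : orderType d, C T /\ infinite_set (@setT T)) ->
     undecidable code_horn is_core (satisfiable C)) /\
  undecidable code_horn is_core (satisfiable (@Fin d)).
Proof.
split.
  move=> C [T [CT /infinite_chain Tinf]].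
  have [o [q Hq]] : exists o : bool, exists q : nat -> T,
      forall i, if o then (q i.+1 < q i)%O else (q i < q i.+1)%O.
    by case: Tinf => -[q Hq]; [exists false, q | exists true, q].
  (* A halting run excludes models over every order, while a diverging one has a model over the
     given infinite order [T]. *)
  apply: (@undecidable_satisfiable d C true o) => c r n Hn.
    by exists T; split=> //; exact: sat_diverges Hq Hn.
  by move=> [T' [_ [V [i]]]]; exact: unsat_halts Hn _ _ _ _.
apply: (@undecidable_satisfiable d _ false false) => c r n Hn; last first.
  by move=> [T' [FT [V [i]]]]; exact: unsat_diverges.
(* All displays are equal, so the orders ['I_m] are available under the given one. *)
have -> : d = ord_display by case: d => [[] []]; case: ord_display => [[] []].
have [m [V [i Hi]]] := sat_halts (erefl false) (erefl false) Hn.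
by exists 'I_m; split; [exact: finite_finset | exists V, i].
Qed.
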